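(* Let $\succsim$ be a binary relation on $\mathcal{F}$. The following conditions are equivalent: (i) $\succsim$ is an invariant biseparable (IB) preference; (ii) there exist a nonconstant affine function $u:X\to\mathbb{R}$ and a family $\mathscr{P}$ consisting of some convex and compact subsets $P\subseteq\Delta$ such that, for any $f,g\in\mathcal{F}$, $$f\succsim g\iff\max_{P\in\mathscr{P}}\min_{p\in P}\int u(f)\,dp\ge\max_{P\in\mathscr{P}}\min_{p\in P}\int u(g)\,dp;\qquad(\ast)$$ (iii) there exist a nonconstant affine function $u:X\to\mathbb{R}$ and a family $\mathscr{Q}$ consisting of some convex and compact subsets $Q\subseteq\Delta$ such that, for any $f,g\in\mathcal{F}$, $$f\succsim g\iff\min_{Q\in\mathscr{Q}}\max_{q\in Q}\int u(f)\,dq\ge\min_{Q\in\mathscr{Q}}\max_{q\in Q}\int u(g)\,dq.\qquad(\ast\ast)$$ Moreover, the function $u$ is cardinally unique (i.e. unique up to positive affine transformations); given $u$, there is a (unique) maximal (with respect to inclusion) family $\mathscr{P}^*$ satisfying $(\ast)$ for all $f,g\in\mathcal F$, given by $$\mathscr{P}^*=\left\{P\subseteq\Delta\ \middle|\ P\text{ is convex and compact},\ \min_{p\in P}\int u(f)\,dp\le u(x_f)\text{ for all }f\in\mathcal{F}\right\},$$ and there is a (unique) maximal family $\mathscr{Q}^*$ satisfying $(\ast\ast)$ for all $f,g\in\mathcal F$, given by $$\mathscr{Q}^*=\left\{Q\subseteq\Delta\ \middle|\ Q\text{ is convex and compact},\ \max_{q\in Q}\int u(f)\,dq\ge u(x_f)\text{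 for all }f\in\mathcal{F}\right\}.$$
   Context: Setting. $S$ is a nonempty set, $\Sigma$ an algebra of subsets of $S$, $X$ a nonempty convex subset of a real vector space. $\mathcal{F}$ is the set of simple acts: $\Sigma$-measurable maps $f:S\to X$ with finitely many values. Each $x\in X$ is identified with the constant act equal to $x$. Mixtures $\alpha f+(1-\alpha)g$ ($\alpha\in[0,1]$) are defined statewise. For $u:X\to\mathbb{R}$ and $f\in\mathcal F$, $u(f)$ is the function $s\mapsto u(f(s))$. $\Delta$ is the set of finitely additive probabilities on $\Sigma$, endowed with the weak* topology $\sigma(\Delta,B_0(\Sigma))$, where $B_0(\Sigma)$ is the space of real-valued $\Sigma$-measurable functions on $S$ with finitely many values. For a binary relation $\succsim$ on $\mathcal F$, $\sim$ and $\succ$ are its symmetric and asymmetric parts. $\succsim$ is an invariant biseparable (IB) preference if it satisfies: A1 (Weak Order): $\succsim$ is nontrivial ($f\succ g$ for some $f,g\in\mathcal F$), complete and transitive. A2 (Monotonicity): for $f,g\in\mathcal F$, if $f(s)\succsim g(s)$ for all $s\in S$, then $f\succsim g$. A3 (Archimedean): for $f,g,h\in\mathcal F$ with $f\succ g\succ h$ there are $\alpha,\beta\in(0,1)$ with $\alpha f+(1-\alpha)h\succ g\succ\beta f+(1-\beta)h$. A7 (C-Independence): for all $f,g\in\mathcal F$, $x\in X$, $\alpha\in(0,1)$: $f\succsim g\iff\alpha f+(1-\alpha)x\succsim\alpha g+(1-\alpha)x$. $x_f\in X$ denotes a certainty equivalent of $f$, i.e. $x_f\sim f$. The families $\mathscr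 P,\mathscr Q$ and their members are understood to be nonempty. Writing $\max$ or $\min$ means that the supremum or infimum is attained. *)

(* Defs.v *)
From HB Require Import structures.
From mathcomp Require Import all_boot all_order all_algebra.
From mathcomp Require Import all_classical all_reals all_analysis.
Set Implicit Arguments.
Unset Strict Implicit.
Unset Printing Implicit Defensive.
Import Order.TTheory GRing.Theory Num.Theory.
Import numFieldNormedType.Exports.
Local Open Scope classical_set_scope.
Local Open Scope ring_scope.

Section extrema.
Context {R : realType}.
Implicit Type A : set R.

(* [sup] and [inf] are total on [set R]; when [has_max A] (resp. [has_min A])
   holds, [sup A] (resp. [inf A]) is the maximum (resp. minimum) of [A]. *)
Definition has_max A := exists2 m, A m & ubound A m.
Definition has_min A := exists2 m, A m & lbound A m.

End extrema.

Section simple_functions.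
Context {d : measure_display} {S : algebraOfSetsType d}.

(* As [f] has finitely many values, measurability of the fibres amounts to
   measurability of the preimage of every subset of [T]. *)
Definition simple {T : Type} (f : S -> T) :=
  finite_set (range f) /\ forall x : T, measurable (f @^-1` [set x]).

Definition B0 (R : realType) : set (S -> R) := [set phi | simple phi].

End simple_functions.
Arguments B0 {d} S R.

Section probabilities.
Context {d : measure_display} (S : algebraOfSetsType d) (R : realType).

(* A set function defined on the algebra is encoded as a function on all
   subsets of [S] that vanishes outside the algebra, so that two elements of
   [Delta] are equal as soon as they agree on the algebra. *)
Definition Delta : set (set S -> R^o) := [set p |
  [/\ forall A, measurable A -> 0 <= p A,
      forall A B, measurable A -> measurable B -> A `&` B = set0 ->
        p (A `|` B) = p A + p B,
      p setT = 1
    & forall A, ~ measurable A -> p A = 0]].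

Definition prob_integral (p : set S -> R^o) (phi : S -> R) : R :=
  fine (sintegral (EFin \o p) phi).

Definition integral_against (p : set S -> R^o) :
    {ptws set_type (B0 S R) -> R} := fun phi => prob_integral p (val phi).

(* The initial topology of [integral_against] is the coarsest one making every
   [prob_integral ^~ phi] with [phi] in [B0 S R] continuous; the topology it
   induces on [Delta] is the weak* topology. *)
Definition weak_star_compact (P : set (set S -> R^o)) :=
  compact (P : set (initial_topology integral_against)).

Definition convex_compact (P : set (set S -> R^o)) :=
  [/\ P `<=` Delta, P !=set0, convex_set P & weak_star_compact P].

End probabilities.
Arguments Delta {d} S R.

Section preferences.
Context {R : realType} {d : measure_display} {S : algebraOfSetsType d}
  {V : lmodType R}.
Variables (X : set V) (pref : (S -> V) -> (S -> V) -> Prop).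
Implicit Types (f g h : S -> V) (x y : V) (u : V -> R).

Definition acts : set (S -> V) := [set f | simple f /\ range f `<=` X].

Definition mix (a : R) f g : S -> V := a *: f + (1 - a) *: g.

Definition strict f g := pref f g /\ ~ pref g f.
Definition indiff f g := pref f g /\ pref g f.

Definition weak_order :=
  [/\ exists f g, [/\ acts f, acts g & strict f g],
      forall f g, acts f -> acts g -> pref f g \/ pref g f
    & forall f g h, acts f -> acts g -> acts h ->
        pref f g -> pref g h -> pref f h].

Definition monotonicity := forall f g, acts f -> acts g ->
  (forall s, pref (cst (f s)) (cst (g s))) -> pref f g.

Definition archimedean := forall f g h, acts f -> acts g -> acts h ->
  strict f g -> strict g h ->
  exists a b : R, [/\ 0 < a < 1, 0 < b < 1,
    strict (mix a f h) g & strict g (mix b f h)].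

Definition c_independence := forall f g x (a : R),
  acts f -> acts g -> X x -> 0 < a < 1 ->
  (pref f g <-> pref (mix a f (cst x)) (mix a g (cst x))).

Definition invariant_biseparable :=
  [/\ weak_order, monotonicity, archimedean & c_independence].

Definition affine_on u := forall x y (a : R), X x -> X y -> 0 <= a <= 1 ->
  u (a *: x + (1 - a) *: y) = a * u x + (1 - a) * u y.

Definition nonconstant_affine u :=
  affine_on u /\ exists x y, [/\ X x, X y & u x <> u y].

Definition integrals (P : set (set S -> R^o)) (phi : S -> R) : set R :=
  [set prob_integral p phi | p in P].

Definition maxmin (PP : set (set (set S -> R^o))) (phi : S -> R) : R :=
  sup [set inf (integrals P phi) | P in PP].
Definition minmax (QQ : set (set (set S -> R^o))) (phi : S -> R) : R :=
  inf [set sup (integrals Q phi) | Q in QQ].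

Definition maxmin_attained (PP : set (set (set S -> R^o))) (phi : S -> R) :=
  (forall P, PP P -> has_min (integrals P phi)) /\
  has_max [set inf (integrals P phi) | P in PP].
Definition minmax_attained (QQ : set (set (set S -> R^o))) (phi : S -> R) :=
  (forall Q, QQ Q -> has_max (integrals Q phi)) /\
  has_min [set sup (integrals Q phi) | Q in QQ].

Definition maxmin_representation u (PP : set (set (set S -> R^o))) :=
  [/\ PP !=set0,
      forall P, PP P -> convex_compact P,
      forall f, acts f -> maxmin_attained PP (u \o f)
    & forall f g, acts f -> acts g ->
        (pref f g <-> maxmin PP (u \o f) >= maxmin PP (u \o g))].

Definition minmax_representation u (QQ : set (set (set S -> R^o))) :=
  [/\ QQ !=set0,
      forall Q, QQ Q -> convex_compact Q,
      forall f, acts f -> minmax_attained QQ (u \o f)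
    & forall f g, acts f -> acts g ->
        (pref f g <-> minmax QQ (u \o f) >= minmax QQ (u \o g))].

(* [u] is a function as in one of the two representations. *)
Definition utility u := nonconstant_affine u /\
  ((exists PP, maxmin_representation u PP) \/
   (exists QQ, minmax_representation u QQ)).

Definition certainty_equivalent f x := X x /\ indiff (cst x) f.

(* As [certainty_equivalent f x] may hold for several [x], the inequalities
   below are required for each of them. *)
Definition Pstar u : set (set (set S -> R^o)) := [set P | convex_compact P /\
  forall f x, acts f -> certainty_equivalent f x ->
    inf (integrals P (u \o f)) <= u x].

Definition Qstar u : set (set (set S -> R^o)) := [set Q | convex_compact Q /\
  forall f x, acts f -> certainty_equivalent f x ->
    sup (integrals Q (u \o f)) >= u x].

End preferences.

Definition maximal_family {T : Type} (C : set (set T)) (F : set T) :=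
  C F /\ forall G, C G -> F `<=` G -> G = F.

(* Main.v *)
Require Import Defs.
From HB Require Import structures.
From mathcomp Require Import all_boot all_order all_algebra.
From mathcomp Require Import all_classical all_reals all_analysis.
From mathcomp Require Import ring lra.
Set Implicit Arguments.
Unset Strict Implicit.
Unset Printing Implicit Defensive.
Import Order.TTheory GRing.Theory Num.Theory.
Import numFieldNormedType.Exports.
Local Open Scope classical_set_scope.
Local Open Scope ring_scope.

(* Everything rests on one two-dimensional separation argument. Let x_f, x_g be
   certainty equivalents of f, g. Then some p in Delta satisfies both
     int u(f) dp <= u(x_f)   and   int u(g) dp >= u(x_g),
   and p can be taken to be a mixture of two point masses. Otherwise there
   would be a in [0, 1] such that a f + (1 - a) x_g strictly dominates
   (1 - a) g + a x_f in every state, whereas C-independence makes both acts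
   indifferent to a x_f + (1 - a) x_g. Hence the half-space
     P_g = {p | int u(g) dp >= u(x_g)}
   belongs to P* and attains the value u(x_g) at g, which gives the max-min
   representation by P*. The half-spaces are weak* compact by taking limits
   of set functions along ultrafilters.
   The utility u comes from C-independence on constant acts: the directions
   s (x - y) with x preferred to y form a total Archimedean cone in the
   directions of X, which is the positive cone of a linear functional.
   Min-max representations are max-min representations of the reversed
   preference with utility -u. *)

(** * Simple maps on an algebra of sets *)

Section simple_functions.
Context {d : measure_display} {S : algebraOfSetsType d}.

Lemma range_seq {T : choiceType} (f : S -> T) : finite_set (range f) ->
  exists2 r : seq T, uniq r & forall s, f s \in r.
Proof.
move=> /finite_seqP[r rE]; exists (undup r); first exact: undup_uniq.
move=> s; rewrite mem_undup.
by have : range f (f s) by []; rewrite rE.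
Qed.

Lemma simple_preimage {T : choiceType} (f : S -> T) (B : set T) :
  simple f -> measurable (f @^-1` B).
Proof.
move=> [ff mf].
have -> : f @^-1` B = \bigcup_(x in range f `&` B) (f @^-1` [set x]).
  apply/seteqP; split=> s /=; first by move=> Bfs; exists (f s).
  by move=> [x [_ Bx] /= ->].
by apply: fin_bigcup_measurable => [|x _]; [exact: finite_setIl|exact: mf].
Qed.

Lemma simple_comp {T U : choiceType} (g : T -> U) (f : S -> T) :
  simple f -> simple (g \o f).
Proof.
move=> sf; split=> [|x]; last by rewrite comp_preimage; exact: simple_preimage.
rewrite (_ : range (g \o f) = g @` range f); first exact: finite_image sf.1.
by rewrite image_comp.
Qed.

(** Followed by [simple_comp], it makes every statewise combination of two simple maps simple:
    mixtures of acts, differences of utilities, and so on. *)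
Lemma simple_pair {T U : choiceType} (f : S -> T) (g : S -> U) :
  simple f -> simple g -> simple (fun s => (f s, g s)).
Proof.
move=> [ff mf] [fg mg]; split=> [|[x y]].
  apply: (@sub_finite_set _ _ (range f `*` range g)); last exact: finite_setX.
  by move=> _ [s _ <-].
rewrite (_ : _ @^-1` _ = f @^-1` [set x] `&` g @^-1` [set y]).
  exact: measurableI.
by apply/seteqP; split=> s /= => [[-> ->]|[-> ->]].
Qed.

Lemma simple_cst {T : Type} (x : T) : simple (cst x : S -> T).
Proof.
split=> [|y]; first by apply: (sub_finite_set _ (finite_set1 x)) => _ [s _ <-].
rewrite preimage_cst.
by case: ifP => _; [exact: measurableT|exact: measurable0].
Qed.

End simple_functions.

(** * Integration of simple functions against finitely additive probabilities *)

Section integral.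
Context {d : measure_display} {S : algebraOfSetsType d} {R : realType}.
Implicit Types (p q : set S -> R^o) (phi psi : S -> R).

Lemma Delta_set0 p : Delta S R p -> p set0 = 0.
Proof.
move=> [_ pU _ _]; apply: (@addrI _ (p set0)).
by rewrite addr0 -pU ?setI0 ?setU0//; exact: measurable0.
Qed.

Lemma Delta_preimage_seq {T : choiceType} p (h : S -> T) (r : seq T) :
  Delta S R p -> simple h -> uniq r ->
  p (h @^-1` [set` r]) = \sum_(t <- r) p (h @^-1` [set t]).
Proof.
move=> Dp sh; elim: r => [_|t r IH /= /andP[tr ur]].
  by rewrite big_nil set_nil preimage_set0 Delta_set0.
rewrite big_cons -IH//; have [_ pU _ _] := Dp.
rewrite -pU; [|exact: simple_preimage|exact: simple_preimage|].
  congr p; apply/seteqP; split=> s /=; rewrite inE.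
    by move=> /orP[/eqP|]; [left|right].
  by move=> [->|->]; rewrite ?eqxx ?orbT.
by apply/seteqP; split=> s //= -[->] rt; move: tr; rewrite rt.
Qed.

Lemma prob_integral_sum p phi (r : seq R) :
  Delta S R p -> uniq r -> (forall s, phi s \in r) ->
  prob_integral p phi = \sum_(x <- r) x * p (phi @^-1` [set x]).
Proof.
move=> Dp ur rphi; rewrite /prob_integral /sintegral (@fsbigE _ _ _ _ _ r)//.
  rewrite -sum_fine//=.
  by apply: eq_bigl => x; rewrite in_setT.
move=> x _ xr; rewrite (_ : phi @^-1` _ = set0) /= ?Delta_set0 ?mule0//.
by apply/seteqP; split=> s //= sx; move: xr; rewrite -sx rphi.
Qed.

(** Computing on the possibly finer partition into fibres of [h] lets two functions of [h] be
    compared term by term. Each fibre of [g \o h] is cut into fibres of [h], then the two sums are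
    exchanged. *)
Lemma prob_integral_comp {T : choiceType} p (h : S -> T) (g : T -> R)
    (r : seq T) :
  Delta S R p -> simple h -> uniq r -> (forall s, h s \in r) ->
  prob_integral p (g \o h) = \sum_(t <- r) g t * p (h @^-1` [set t]).
Proof.
move=> Dp sh ur rh.
rewrite (@prob_integral_sum _ _ (undup (map g r)))//; first last.
- by move=> s; rewrite mem_undup; apply: map_f.
- exact: undup_uniq.
transitivity (\sum_(x <- undup (map g r)) \sum_(t <- r)
    if g t == x then g t * p (h @^-1` [set t]) else 0).
  apply: eq_bigr => x _; rewrite -big_mkcond.
  transitivity (x * \sum_(t <- r | g t == x) p (h @^-1` [set t])).
    congr (_ * _); rewrite -big_filter -Delta_preimage_seq ?filter_uniq//.
    congr p; apply/seteqP; split=> s /=; rewrite mem_filter rh andbT.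
      by move=> ->.
    by move/eqP.
  by rewrite mulr_sumr; apply: eq_bigr => t /eqP ->.
rewrite exchange_big big_seq [RHS]big_seq; apply: eq_bigr => t tr.
rewrite (bigD1_seq (g t)) ?undup_uniq ?mem_undup ?map_f//= eqxx big1 ?addr0//.
by move=> x; rewrite eq_sym => /negbTE ->.
Qed.

Lemma prob_integral_le p phi psi : Delta S R p -> simple phi -> simple psi ->
  (forall s, phi s <= psi s) -> prob_integral p phi <= prob_integral p psi.
Proof.
move=> Dp sphi spsi le; pose h s := (phi s, psi s).
have sh : simple h by exact: simple_pair.
have [r ur rh] := range_seq sh.1.
rewrite (prob_integral_comp fst Dp sh ur rh).
rewrite (prob_integral_comp snd Dp sh ur rh).
(* The list [r] may contain pairs that [h] never takes, where nothing compares the coordinates;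
   their fibre is empty and has mass 0. *)
apply: ler_sum => t _; have [[s hs]|ns] := pselect (exists s, h s = t).
  rewrite -hs ler_wpM2r ?le//=; have [p0 _ _ _] := Dp.
  by apply: p0; exact: simple_preimage.
rewrite (_ : h @^-1` _ = set0) ?Delta_set0 ?mulr0//.
by apply/seteqP; split=> s //= hs; apply: ns; exists s.
Qed.

Lemma prob_integral_affine p phi (a b : R) : Delta S R p -> simple phi ->
  prob_integral p (fun s => a * phi s + b) = a * prob_integral p phi + b.
Proof.
move=> Dp sphi; have [r ur rh] := range_seq sphi.1.
rewrite (prob_integral_comp (fun x => a * x + b) Dp sphi ur rh).
rewrite (prob_integral_sum Dp ur rh) mulr_sumr.
have E : b = \sum_(t <- r) b * p (phi @^-1` [set t]).
  rewrite -mulr_sumr -Delta_preimage_seq//.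
  rewrite (_ : _ @^-1` _ = setT); last first.
    by apply/seteqP; split=> s //= _; exact: rh.
  by have [_ _ -> _] := Dp; rewrite mulr1.
rewrite [X in _ + X]E -big_split/=; apply: eq_bigr => t _.
by rewrite mulrDl mulrA.
Qed.

Lemma prob_integral_cst p (c : R) : Delta S R p -> prob_integral p (cst c) = c.
Proof.
move=> Dp; have := prob_integral_affine 0 c Dp (simple_cst c).
rewrite mul0r add0r => E; rewrite -[RHS]E.
by congr prob_integral; apply/funext => s /=; rewrite mul0r add0r.
Qed.

Lemma prob_integralN p phi : Delta S R p -> simple phi ->
  prob_integral p (- phi) = - prob_integral p phi.
Proof.
move=> Dp sphi; have := prob_integral_affine (-1) 0 Dp sphi.
rewrite mulN1r addr0 => <-; congr prob_integral; apply/funext => s /=.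
by rewrite mulN1r addr0.
Qed.

Lemma Delta_convex p q (w : R) : 0 <= w <= 1 -> Delta S R p -> Delta S R q ->
  Delta S R (w *: p + (1 - w) *: q).
Proof.
move=> /andP[w0 w1] [p0 pU p1 pN] [q0 qU q1 qN].
have w1' : 0 <= 1 - w by rewrite subr_ge0.
split=> [A mA|A B mA mB AB||A nA] /=.
- by rewrite addr_ge0// mulr_ge0// ?p0 ?q0.
- rewrite !fctE /= pU// qU//; rewrite /GRing.scale/=; ring.
- by rewrite !fctE p1 q1 /GRing.scale/=; ring.
- by rewrite !fctE pN// qN// !scaler0 addr0.
Qed.

Lemma prob_integral_convex p q (w : R) phi : 0 <= w <= 1 ->
  Delta S R p -> Delta S R q -> simple phi ->
  prob_integral (w *: p + (1 - w) *: q) phi =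
  w * prob_integral p phi + (1 - w) * prob_integral q phi.
Proof.
move=> w01 Dp Dq sphi; have [r ur rh] := range_seq sphi.1.
rewrite (prob_integral_sum Dp ur rh) (prob_integral_sum Dq ur rh).
rewrite (prob_integral_sum (Delta_convex w01 Dp Dq) ur rh).
rewrite !mulr_sumr -big_split/=; apply: eq_bigr => x _.
by rewrite !fctE /GRing.scale/=; ring.
Qed.

(** The measurability conjunct makes the Dirac mass vanish outside the algebra, as [Delta]
    demands. *)
Definition point_mass (s : S) : set S -> R^o :=
  fun A => `[< measurable A /\ A s >]%:R.

Lemma Delta_point_mass s : Delta S R (point_mass s).
Proof.
rewrite /point_mass; split=> [A _|A B mA mB AB||A nA].
- by rewrite ler0n.
- have [As|As] := pselect (A s).
    have nB : ~ B s by move=> Bs; have : (A `&` B) s by []; rewrite AB.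
    rewrite [in LHS]asboolT; last by split; [exact: measurableU|left].
    by rewrite asboolT// asboolF ?addr0// => -[].
  rewrite (asbool_equiv_eq (_ : _ <-> measurable B /\ B s)).
    by rewrite (@asboolF (_ /\ A s)) ?add0r// => -[].
  split=> [[_ [//|Bs]]|[_ Bs]]; split=> //; last by right.
  exact: measurableU.
- by rewrite asboolT//; split=> //; exact: measurableT.
- by rewrite asboolF// => -[].
Qed.

Lemma prob_integral_point_mass s phi : simple phi ->
  prob_integral (point_mass s) phi = phi s.
Proof.
move=> sphi; have [r ur rh] := range_seq sphi.1.
rewrite (prob_integral_sum (Delta_point_mass s) ur rh).
rewrite (bigD1_seq (phi s))//= big1 ?addr0.
  by rewrite /point_mass asboolT ?mulr1//; split=> //; exact: simple_preimage.
move=> x xs; rewrite /point_mass asboolF ?mulr0// => -[_ /= sx].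
by move: xs; rewrite sx eqxx.
Qed.

End integral.

(** * Weak* compactness by ultrafilter limits *)

Section weak_star.
Context {d : measure_display} {S : algebraOfSetsType d} {R : realType}.
Implicit Types (p q : set S -> R^o) (phi psi : S -> R).

(** The image filter has a cluster point in the compact segment, and for an ultrafilter a cluster
    point is a limit. *)
Lemma ultra_bounded_cvg {T : Type} (F : set_system T) (f : T -> R) (a b : R) :
  UltraFilter F -> (\forall x \near F, a <= f x <= b) ->
  exists l : R, f @ F --> l.
Proof.
move=> UF fab; have PF := @ultra_proper _ F UF.
have [|l [_ Gl]] := @segment_compact R a b (f @ F) _; first exact: fab.
exists l => U Ul; have [//|FnU] := in_ultra_setVsetC (f @^-1` U) UF.
by have [y []] := Gl (~` U) U FnU Ul.
Qed.

Lemma cvg_near_ge {T : Type} (F : set_system T) (f : T -> R) (l c : R) :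
  ProperFilter F -> f @ F --> l -> (\forall x \near F, c <= f x) -> c <= l.
Proof.
move=> FF fl cf; rewrite -(cvg_lim (@Rhausdorff R) fl); apply: limr_ge => //.
by apply/cvg_ex; exists l.
Qed.

(** Neighbourhoods in the initial topology contain preimages of open sets. The lemma serves at two
    levels: for [integral_against], and for each evaluation defining the pointwise topology. *)
Lemma initial_topology_cvg {T : choiceType} {U : topologicalType} (f : T -> U)
    (F : set_system T) (x : T) : Filter F ->
  f @ F --> f x -> F --> (x : initial_topology f).
Proof.
move=> FF fF A /= [_ [[B Bop <-] Bfx sBA]].
have FB : F (f @^-1` B) by apply: fF; exact: open_nbhs_nbhs.
exact: filterS FB.
Qed.

(** The mass of each measurable set stays in [0, 1], hence converges along the ultrafilter;
    positivity, additivity and total mass pass to the limit. The integral of a simple function is a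
    finite linear combination of masses, so it converges as well. *)
Lemma ultra_prob_limit (F : set_system (set S -> R^o)) :
  UltraFilter F -> F (Delta S R) -> exists2 p, Delta S R p &
    forall phi, simple phi ->
      prob_integral q phi @[q --> F] --> prob_integral p phi.
Proof.
move=> UF FD; have PF := @ultra_proper _ F UF.
have limA A : exists l : R, measurable A -> (q A : R) @[q --> F] --> l.
  have [mA|nA] := pselect (measurable A); last by exists 0.
  have [|l Fl] := @ultra_bounded_cvg _ F (fun q => q A) 0 1; last by exists l.
  apply: filterS FD => q Dq; have [q0 qU q1 _] := Dq.
  rewrite q0//= -q1 -(setUv A) qU ?setICr//; last exact: measurableC.
  by rewrite lerDl q0//; exact: measurableC.
have [l ll] := choice limA.
pose p : set S -> R^o := fun A => if `[< measurable A >] then l A else 0.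
have pF A : measurable A -> (q A : R) @[q --> F] --> p A.
  by move=> mA; rewrite /p asboolT//; exact: ll.
have Dp : Delta S R p.
  split=> [A mA|A B mA mB AB||A nA].
  - apply: (cvg_near_ge _ (pF A mA)).
    by apply: filterS FD => q [q0 _ _ _]; exact: q0.
  - have mAB : measurable (A `|` B) by exact: measurableU.
    apply: (cvg_unique _ (pF _ mAB)); first exact: Rhausdorff.
    apply: cvg_trans (cvgD (pF A mA) (pF B mB)).
    apply: near_eq_cvg; apply: filterS FD => q [_ qU _ _].
    by rewrite /= qU.
  - apply: (cvg_unique _ (pF _ measurableT)); first exact: Rhausdorff.
    have c1 : (1 : R) @[_ --> F] --> (1 : R) by exact: cvg_cst.
    apply: cvg_trans c1.
    apply: near_eq_cvg; apply: filterS FD => q [_ _ q1 _].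
    by rewrite /= q1.
  - by rewrite /p asboolF.
exists p => // phi sphi; have [r ur rh] := range_seq sphi.1.
rewrite (prob_integral_sum Dp ur rh).
apply: (@cvg_trans _
  ((\sum_(x <- r) x * q (phi @^-1` [set x]) : R) @[q --> F])).
  apply: near_eq_cvg; apply: filterS FD => q Dq.
  by rewrite (prob_integral_sum Dq ur rh).
apply: cvg_big => [|x _]; first exact: add_continuous.
by apply: cvgMl_tmp; apply: pF; exact: simple_preimage.
Qed.

Lemma weak_star_compact_halfspace psi (c : R) : simple psi ->
  weak_star_compact [set p | Delta S R p /\ c <= prob_integral p psi].
Proof.
move=> spsi; rewrite /weak_star_compact compact_ultra => F UF FP.
have PF := @ultra_proper _ F UF.
have [|p Dp pF] := @ultra_prob_limit F UF.
  by apply: filterS FP => q [].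
exists p; split.
  split=> //; apply: (cvg_near_ge _ (pF psi spsi)).
  by apply: filterS FP => q [].
apply: initial_topology_cvg; apply/cvg_sup => -[phi sphi].
apply: initial_topology_cvg; exact: (pF phi (set_mem sphi)).
Qed.

(** Integration of [phi] is weak* continuous, being an evaluation after [integral_against], so the
    extreme value theorem applies. *)
Lemma compact_integrals_has_min (P : set (set S -> R^o)) phi :
  P !=set0 -> weak_star_compact P -> simple phi -> has_min (integrals P phi).
Proof.
move=> P0 Pc sphi; pose phi' : B0 S R := exist _ phi (mem_set sphi).
pose W : topologicalType := initial_topology (@integral_against d S R).
have cI : continuous (fun p : W => integral_against p phi').
  move=> p.
  have /cvg_sup/(_ phi') cp :=
    @initial_continuous _ _ (@integral_against d S R) p.
  have c2 := @initial_continuous _ _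
    (fun f : {ptws B0 S R -> R} => f phi') (integral_against p).
  move=> A /c2; apply: cp; apply: fmap_filter.
  exact: (@nbhs_filter W p).
have [p /set_mem Pp pmin] :=
  @compact_EVT_min W R _ P P0 Pc (continuous_subspaceT cI).
exists (prob_integral p phi); first by exists p.
by move=> _ [q Pq <-]; apply: pmin; exact: mem_set.
Qed.

End weak_star.

(** * Two-dimensional separation for functions with finitely many values *)

Section finite_ranges.
Context {R : realType}.

Lemma finite_range_max {T : pointedType} (f : T -> R) :
  finite_set (range f) -> exists t0, forall t, f t <= f t0.
Proof.
move=> /finite_seqP[r rE].
suff [t0 ft0] : exists t0, forall t, f t \in r -> f t <= f t0.
  by exists t0 => t; apply: ft0; have : range f (f t) by []; rewrite rE.
elim: r {rE} => [|x r [t0 ft0]]; first by exists point.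
have [[t1 [ft1 t01]]|nx] := pselect (exists t1, f t1 = x /\ f t0 <= x).
  exists t1 => t; rewrite inE ft1 => /orP[/eqP->//|/ft0 tt0].
  exact: le_trans t01.
exists t0 => t; rewrite inE => /orP[/eqP ftx|/ft0//].
by case: (leP (f t) (f t0)) => // /ltW; rewrite ftx => t0x; case: nx; exists t.
Qed.

(** For a fixed [v] the condition on [a] is a non-strict linear inequality, hence closed; finiteness
    of [K] keeps the union closed. *)
Lemma closed_finite_union_slopes (K : set (R * R)) : finite_set K ->
  closed [set a : R | exists2 v, K v & a * v.1 <= (1 - a) * v.2].
Proof.
move=> finK.
rewrite (_ : mkset _ = \bigcup_(v in K) [set a | a * (v.1 + v.2) <= v.2]).
  apply: closed_bigcup => // v _.
  apply: (@preimage_closed R R ( *%R^~ (v.1 + v.2)) [set x | x <= v.2]).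
    by move=> x _; exact: mulrr_continuous.
  exact: closed_le.
have E (a : R) (v : R * R) :
    (a * v.1 <= (1 - a) * v.2) = (a * (v.1 + v.2) <= v.2).
  by rewrite mulrDr mulrBl mul1r lerBrDr.
by apply/seteqP; split=> a [v Kv av]; exists v => //; move: av; rewrite /= E.
Qed.

(* The two closed sets of those [a] for which some state with [0 <= psi]
   (resp. [phi <= 0]) satisfies the inequality cover the connected interval
   [0, 1], hence meet. *)
Lemma two_point_mixture {T : Type} (phi psi : T -> R) :
  finite_set (range (fun t => (phi t, psi t))) ->
  (forall a, 0 <= a <= 1 -> exists t, a * phi t <= (1 - a) * psi t) ->
  exists s t w, [/\ 0 <= w <= 1, w * phi s + (1 - w) * phi t <= 0 &
    0 <= w * psi s + (1 - w) * psi t].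
Proof.
set K := range _ => finK le.
pose A := [set a : R | exists2 v, (K `&` [set v | 0 <= v.2]) v &
  a * v.1 <= (1 - a) * v.2].
pose B := [set a : R | exists2 v, (K `&` [set v | v.1 <= 0]) v &
  a * v.1 <= (1 - a) * v.2].
have clA : closed A by apply: closed_finite_union_slopes; exact: finite_setIl.
have clB : closed B by apply: closed_finite_union_slopes; exact: finite_setIl.
have AB a : 0 <= a <= 1 -> A a \/ B a.
  move=> /[dup] a01 /le[t at_]; have [p0|p0] := leP 0 (psi t).
    by left; exists (phi t, psi t) => //; split=> //; exists t.
  have [f0|f0] := leP (phi t) 0.
    by right; exists (phi t, psi t) => //; split=> //; exists t.
  by exfalso; move: a01 => /andP[a0 a1]; nra.
have [a [a01 [Aa Ba]]] : exists a : R, 0 <= a <= 1 /\ A a /\ B a.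
  apply: contrapT => nAB.
  have : `[0, 1]%classic `&` A = `[0, 1]%classic.
    apply: (@segment_connected R 0 1); last by exists A.
    - exists 0; split; first by rewrite /= in_itv/= lexx ler01.
      have [|//|[v [Kv /= v0]]] := AB 0; first by rewrite lexx ler01.
      rewrite mul0r subr0 mul1r => v2; exists v => //.
      by rewrite mul0r subr0 mul1r.
    - exists (~` B); first exact: closed_openC.
      apply/seteqP; split=> a [/=]; rewrite in_itv/= => a01 Aa; split=> //.
        by move=> Ba; apply: nAB; exists a.
      by have [] := AB a a01.
  move/seteqP => [_ /(_ 1)] [|_ A1]; first by rewrite /= in_itv/= lexx ler01.
  apply: nAB; exists 1; rewrite lexx ler01; split=> //; split=> //.
  have [|t] := le 1; first by rewrite lexx ler01.
  rewrite mul1r subrr mul0r => f0; exists (phi t, psi t) => /=.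
    by split=> //; exists t.
  by rewrite mul1r subrr mul0r.
(* Here [0 <= psi s] and [phi t <= 0]. If one of the two states satisfies both sign conditions it
   suffices alone; otherwise [phi s > 0] and [psi t < 0], and a proper mixture is used. *)
move: Aa Ba => [_ [[s _ <-] /= s2] sa] [_ [[t _ <-] /= t1] ta].
have [s1|s1] := leP (phi s) 0.
  by exists s, s, 1; rewrite lexx ler01; split=> //; lra.
have [t2|t2] := leP 0 (psi t).
  by exists t, t, 1; rewrite lexx ler01; split=> //; lra.
have st : 0 < phi s - phi t by rewrite subr_gt0 (le_lt_trans t1).
(* This weight makes the mixture of [phi] vanish. Averaging the inequalities [sa] and [ta] with it
   then bounds the mixture of [psi] below by 0, after division by [1 - a]. *)
exists s, t, (- phi t / (phi s - phi t)); move: a01 => /andP[a0 a1].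
set w := _ / _; have wE : w * (phi s - phi t) = - phi t.
  by rewrite /w divfK// gt_eqF.
have w0 : 0 <= w by rewrite divr_ge0 ?oppr_ge0// ltW.
have w1 : w <= 1 by rewrite ler_pdivrMr// mul1r; lra.
have E : w * phi s + (1 - w) * phi t = 0.
  by rewrite -(subrr (phi t)) -wE; ring.
split; [by rewrite w0|by rewrite E|].
(* For [a = 1], [sa] would read [phi s <= 0]. *)
have a1' : a < 1 by rewrite lt_neqAle a1 andbT; apply/eqP => a1E; subst a; nra.
rewrite -(pmulr_rge0 _ (_ : 0 < 1 - a)) ?subr_gt0//.
have := ler_wpM2l w0 sa; have := @ler_wpM2l _ (1 - w) _ _ _ ta.
rewrite subr_ge0 => /(_ w1) H1 H2.
rewrite -(mulr0 a) -E; lra.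
Qed.

End finite_ranges.

(** * Certainty equivalents of an invariant biseparable preference *)

Section preference.
Context {R : realType} {d : measure_display} {S : algebraOfSetsType d}
  {V : lmodType R}.
Variables (X : set V) (pref : (S -> V) -> (S -> V) -> Prop).
Hypothesis Xconvex : convex_set X.
Implicit Types (f g h : S -> V) (x y : V) (u v : V -> R) (a b w : R).

Lemma convex_mem x y a : X x -> X y -> 0 <= a <= 1 -> X (a *: x + (1 - a) *: y).
Proof.
move=> Xx Xy /andP[a0 a1].
exact: (set_mem (Xconvex (Itv01 a0 a1) (mem_set Xx) (mem_set Xy))).
Qed.

Lemma acts_cst x : X x -> acts X (cst x : S -> V).
Proof. by move=> Xx; split; [exact: simple_cst|move=> _ [s _ <-]]. Qed.

Lemma actsX f s : acts X f -> X (f s).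
Proof. by move=> [_]; apply; exists s. Qed.

Lemma acts_mix f g a : acts X f -> acts X g -> 0 <= a <= 1 ->
  acts X (mix a f g).
Proof.
move=> Af Ag a01; split; last first.
  by move=> _ [s _ <-]; apply: convex_mem => //; exact: actsX.
exact: (simple_comp (fun v : V * V => a *: v.1 + (1 - a) *: v.2)
  (simple_pair Af.1 Ag.1)).
Qed.

Lemma acts_utility u f : acts X f -> simple (u \o f).
Proof. by case=> sf _; exact: simple_comp. Qed.

Lemma mix_cst x y a :
  mix a (cst x) (cst y) = cst (a *: x + (1 - a) *: y) :> (S -> V).
Proof. by []. Qed.

Lemma affine_mix u f g a s : affine_on X u -> acts X f -> acts X g ->
  0 <= a <= 1 -> u (mix a f g s) = a * u (f s) + (1 - a) * u (g s).
Proof. by move=> au Af Ag a01; apply: au => //; exact: actsX. Qed.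

(** The meeting point of the axioms and the two representations: only the ranking of constant acts
    ties [u] to the preference. It is shown equivalent to [utility] in [utilityE]. *)
Definition IB_utility u := [/\ nonconstant_affine X u,
  invariant_biseparable X pref &
  forall x y, X x -> X y -> (pref (cst x) (cst y) <-> u y <= u x)].

Section IB_utility.
Variable u : V -> R.
Hypothesis ibu : IB_utility u.

Let au : affine_on X u. Proof. by case: ibu => -[]. Qed.

Let pref_cst x y : X x -> X y -> (pref (cst x) (cst y) <-> u y <= u x).
Proof. by have [_ _ pc] := ibu; exact: pc. Qed.

Let total f g : acts X f -> acts X g -> pref f g \/ pref g f.
Proof. by have [_ [[_ tot _] _ _ _] _] := ibu; exact: tot. Qed.

Let trans f g h : acts X f -> acts X g -> acts X h ->
  pref f g -> pref g h -> pref f h.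
Proof. by have [_ [[_ _ tr] _ _ _] _] := ibu; exact: tr. Qed.

Let not_pref f g : acts X f -> acts X g -> ~ pref f g -> strict pref g f.
Proof. by move=> Af Ag nfg; split=> //; case: (total Af Ag). Qed.

Lemma IB_utility_mono f g : acts X f -> acts X g ->
  (forall s, u (g s) <= u (f s)) -> pref f g.
Proof.
move=> Af Ag gf; have [_ [_ mono _ _] _] := ibu.
by apply: mono => // s; apply/pref_cst => //; exact: actsX.
Qed.

Lemma IB_utility_cst_mix f g x a : acts X f -> acts X g -> X x -> 0 < a < 1 ->
  (pref f g <-> pref (mix a f (cst x)) (mix a g (cst x))).
Proof. by have [_ [_ _ _ ci] _] := ibu; exact: ci. Qed.

(** On the segment from the worst value [x0] of [f] to the best value [x1], the candidate sits at
    the supremum of the weights whose point is no better than [f]. If [f] were strictly better, the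
    Archimedean axiom would put a larger weight in [T]; if strictly worse, it would give a smaller
    upper bound of [T]. The extreme weights 1 and 0 are excluded by [nf1] and [nf0]. *)
Lemma certainty_equivalent_exists f : acts X f ->
  exists x, certainty_equivalent X pref f x.
Proof.
move=> Af; have fin_u : finite_set (range (u \o f)) := (acts_utility u Af).1.
have [s1 max1] := finite_range_max fin_u.
have [s0 min0] : exists s0, forall s, u (f s0) <= u (f s).
  have [|s0 s0min] := @finite_range_max _ _ (-%R \o (u \o f)).
    rewrite (_ : range _ = -%R @` range (u \o f)); last by rewrite image_comp.
    exact: finite_image.
  by exists s0 => s; have := s0min s; rewrite /= lerN2.
set x1 := f s1 in max1 *; set x0 := f s0 in min0 *.
have X1 : X x1 by exact: actsX.
have X0 : X x0 by exact: actsX.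
have A1 := acts_cst X1; have A0 := acts_cst X0.
have f1 : pref (cst x1) f by apply: IB_utility_mono => // s; exact: max1.
have f0 : pref f (cst x0) by apply: IB_utility_mono => // s; exact: min0.
have [f1'|nf1] := pselect (pref f (cst x1)); first by exists x1.
have [f0'|nf0] := pselect (pref (cst x0) f); first by exists x0.
have u01 : u x0 < u x1.
  rewrite ltNge; apply/negP => u10; apply: nf1.
  by apply: (trans Af A0 A1) => //; exact/pref_cst.
pose m t := t *: x1 + (1 - t) *: x0.
have Xm t : 0 <= t <= 1 -> X (m t) by exact: convex_mem.
have Am t : 0 <= t <= 1 -> acts X (cst (m t) : S -> V).
  by move=> /Xm; exact: acts_cst.
pose T := [set t | 0 <= t <= 1 /\ pref f (cst (m t))].
have T0 : T 0 by rewrite /T /= lexx ler01 /m scale0r add0r subr0 scale1r.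
have supT : has_sup T by split; [exists 0|exists 1 => t [/andP[]]].
have t0 : 0 <= sup T by exact: sup_upper_bound.
have t1 : sup T <= 1 by apply: ge_sup; [exists 0|move=> t [/andP[]]].
have t01 : 0 <= sup T <= 1 by rewrite t0.
have [_ [_ _ arch _] _] := ibu.
exists (m (sup T)); split; first exact: Xm.
split; apply: contrapT => /not_pref n.
- have {n} fz : strict pref f (cst (m (sup T))) by apply: n => //; exact: Am.
  have [_ [b [_ /andP[b0 b1] _ [fb _]]]] := arch _ _ _ A1 Af (Am _ t01)
    (conj f1 nf1) fz.
  have Tb : T (b + (1 - b) * sup T).
    split; first by apply/andP; split; nra.
    move: fb; rewrite mix_cst; congr (pref f (cst _)).
    by rewrite /m scalerDr !scalerA addrA -scalerDl; congr (_ + _ *: _); ring.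
  have := sup_upper_bound supT Tb => le.
  have sT1 : sup T = 1 by nra.
  by apply: nf1; move: fz.1; rewrite sT1 /m scale1r subrr scale0r addr0.
- have {n} zf : strict pref (cst (m (sup T))) f by apply: n => //; exact: Am.
  have [a [_ [/andP[a0 a1] _ [af naf] _]]] := arch _ _ _ (Am _ t01) Af A0
    zf (conj f0 nf0).
  have aT : 0 <= a * sup T <= 1 by apply/andP; split; nra.
  have mE : mix a (cst (m (sup T))) (cst x0) = cst (m (a * sup T)) :> (S -> V).
    rewrite mix_cst /m scalerDr !scalerA -addrA -scalerDl.
    by congr (cst (_ + _ *: _)); ring.
  have : sup T <= a * sup T.
    apply: ge_sup; first by exists 0.
    move=> t [t01' ft].
    have /pref_cst : pref (cst (m (a * sup T))) (cst (m t)).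
      by apply: (trans (Am _ aT) Af (Am _ t01')) => //; rewrite -mE.
    by move=> /(_ (Xm _ aT) (Xm _ t01')); rewrite /m !au//; nra.
  move=> le; have sT0 : sup T = 0 by nra.
  by apply: nf0; move: zf.1; rewrite sT0 /m scale0r add0r subr0 scale1r.
Qed.

Lemma prefE f g x y : acts X f -> acts X g -> certainty_equivalent X pref f x ->
  certainty_equivalent X pref g y -> (pref f g <-> u y <= u x).
Proof.
move=> Af Ag [Xx [xf fx]] [Xy [yg gy]].
have Ax := acts_cst Xx; have Ay := acts_cst Xy.
rewrite -pref_cst//; split=> [fg|xy].
  by apply: (trans Ax Af Ay) => //; exact: (trans Af Ag Ay).
by apply: (trans Af Ax Ag) => //; exact: (trans Ax Ay Ag).
Qed.

Lemma certainty_equivalent_cst x : X x -> certainty_equivalent X pref (cst x) x.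
Proof. by move=> Xx; split=> //; split; apply/pref_cst. Qed.

(** C-independence carries the indifference between [f] and [x] over to the mixtures; the weights 0
    and 1, outside the scope of that axiom, are treated directly. *)
Lemma certainty_equivalent_mix f x y a : acts X f ->
  certainty_equivalent X pref f x -> X y -> 0 <= a <= 1 ->
  certainty_equivalent X pref (mix a f (cst y)) (a *: x + (1 - a) *: y).
Proof.
move=> Af cx Xy a01.
have [->|a0] := eqVneq a 0.
  rewrite /mix !scale0r !add0r subr0 !scale1r; exact: certainty_equivalent_cst.
have [->|a1] := eqVneq a 1.
  by rewrite /mix subrr !scale0r !addr0 !scale1r.
have {a0 a1}a01' : 0 < a < 1 by rewrite !lt_neqAle a1 eq_sym a0.
have [Xx [xf fx]] := cx; have Ax := acts_cst Xx.
split; first exact: convex_mem.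
rewrite /indiff -mix_cst; split.
  exact: (IB_utility_cst_mix Ax Af Xy a01').1.
exact: (IB_utility_cst_mix Af Ax Xy a01').1.
Qed.

(* Mixing [f] with a slightly worse constant than [g] turns the gap between
   [f] and [g] into a strict inequality between certainty equivalents. *)
Lemma statewise_strict_dominance f g x y : acts X f -> acts X g ->
  certainty_equivalent X pref f x -> certainty_equivalent X pref g y ->
  (forall s, u (g s) < u (f s)) -> u y < u x.
Proof.
move=> Af Ag cx cy gf.
have [[_ [x1 [x0 [X1 X0 u10]]]] _ _] := ibu.
wlog {u10} u01 : x1 x0 X1 X0 / u x0 < u x1.
  move=> W; move/eqP : u10; rewrite neq_lt => /orP[/W|/W]; exact.
have [s0 min0] : exists s0, forall s, u (f s0) - u (g s0) <= u (f s) - u (g s).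
  have [|s0 s0min] := @finite_range_max R S (fun s => u (g s) - u (f s)).
    exact: (simple_comp (fun v : V * V => u v.1 - u v.2)
      (simple_pair Ag.1 Af.1)).1.
  by exists s0 => s; rewrite -lerN2 !opprB.
set e := u (f s0) - u (g s0) in min0.
have e0 : 0 < e by rewrite subr_gt0.
set k := u x1 - u x0; have k0 : 0 < k by rewrite subr_gt0.
(* This weight solves [a * e = (1 - a) * k]: the smallest gap [e] between [f] and [g] exactly pays
   for using [x0] in place of [x1]. *)
pose a := k / (e + k).
have ek0 : 0 < e + k by rewrite addr_gt0.
have a0 : 0 < a by rewrite divr_gt0.
have a1 : a < 1 by rewrite ltr_pdivrMr// mul1r ltrDr.
have a01 : 0 <= a <= 1 by rewrite !ltW.
have aE : a * e = (1 - a) * k.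
  have : a * (e + k) = k by rewrite divfK// gt_eqF.
  by rewrite mulrDr mulrBl mul1r; lra.
have A1 := acts_cst X1; have A0 := acts_cst X0.
have : pref (mix a f (cst x0)) (mix a g (cst x1)).
  apply: IB_utility_mono; [exact: acts_mix|exact: acts_mix|].
  move=> s; rewrite !affine_mix//=.
  have := ler_wpM2l (ltW a0) (min0 s); rewrite -/e aE /k; lra.
move/(prefE (acts_mix Af A0 a01) (acts_mix Ag A1 a01)
  (certainty_equivalent_mix Af cx X0 a01)
  (certainty_equivalent_mix Ag cy X1 a01)).
have [Xx _] := cx; have [Xy _] := cy.
rewrite !au// => le; rewrite -subr_gt0 -(pmulr_rgt0 _ a0).
have : 0 < (1 - a) * k by rewrite mulr_gt0// subr_gt0.
rewrite /k; lra.
Qed.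

End IB_utility.

End preference.

(** * Properties of the max-min functional *)

Section extrema.
Context {R : realType}.
Implicit Types (A : set R) (m : R).

Lemma sup_max A m : A m -> ubound A m -> sup A = m.
Proof.
move=> Am um; apply/eqP; rewrite eq_le ge_sup//=; last by exists m.
by apply: ub_le_sup => //; exists m.
Qed.

Lemma inf_min A m : A m -> lbound A m -> inf A = m.
Proof.
move=> Am lm; apply/eqP; rewrite eq_le lb_le_inf ?andbT//; last by exists m.
by apply: ge_inf => //; exists m.
Qed.

End extrema.

Section maxmin.
Context {R : realType} {d : measure_display} {S : algebraOfSetsType d}.
Variable PP : set (set (set S -> R^o)).
Hypotheses (PP0 : PP !=set0) (PPcc : forall P, PP P -> convex_compact P).
Implicit Types (phi psi : S -> R) (a c : R).

Lemma integrals_has_inf P phi : PP P -> simple phi -> has_inf (integrals P phi).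
Proof.
move=> /PPcc[_ P0 _ Pc] sphi.
have [m Pm lm] := compact_integrals_has_min P0 Pc sphi.
by split; exists m.
Qed.

Lemma maxmin_has_sup phi : simple phi ->
  has_sup [set inf (integrals P phi) | P in PP].
Proof.
move=> sphi; split.
  by have [P PPP] := PP0; exists (inf (integrals P phi)), P.
have [s0 smax] := finite_range_max sphi.1.
exists (phi s0) => _ [P PPP <-].
have [[_ [p Pp _]] lb] := integrals_has_inf PPP sphi.
apply: (@le_trans _ _ (prob_integral p phi)).
  by apply: ge_inf => //; exists p.
have [PD _ _ _] := PPcc PPP; have Dp := PD _ Pp.
rewrite -[leRHS](prob_integral_cst _ Dp).
by apply: prob_integral_le => //; exact: simple_cst.
Qed.

(** Positive affine maps and pointwise inequalities pass through the integral, the infimum and the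
    supremum. This one estimate yields the monotonicity, the C-independence and the Archimedean
    property of the represented preference. *)
Lemma le_maxmin phi psi a c : 0 < a -> simple phi -> simple psi ->
  (forall s, a * phi s + c <= psi s) ->
  a * maxmin PP phi + c <= maxmin PP psi.
Proof.
move=> a0 sphi spsi le; rewrite -lerBrDr mulrC -ler_pdivlMr//.
have [ne _] := maxmin_has_sup sphi.
apply: ge_sup => // _ [P PPP <-]; rewrite ler_pdivlMr// lerBrDr mulrC.
apply: (@le_trans _ _ (inf (integrals P psi))); last first.
  by apply: ub_le_sup; [exact: (maxmin_has_sup spsi).2|exists P].
apply: lb_le_inf; first exact: (integrals_has_inf PPP spsi).1.
move=> _ [p Pp <-]; have [PD _ _ _] := PPcc PPP; have Dp := PD _ Pp.
apply: (@le_trans _ _ (a * prob_integral p phi + c)).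
  rewrite lerD2r ler_pM2l//; apply: ge_inf; last by exists p.
  exact: (integrals_has_inf PPP sphi).2.
rewrite -prob_integral_affine//; apply: prob_integral_le => //.
exact: (simple_comp (fun x => a * x + c)).
Qed.

Lemma maxmin_cst c : maxmin PP (cst c) = c.
Proof.
have infc P : PP P -> inf (integrals P (cst c)) = c.
  move=> /PPcc[PD [p Pp] _ _]; apply: inf_min.
    by exists p => //; rewrite prob_integral_cst//; exact: PD.
  by move=> _ [q Pq <-]; rewrite prob_integral_cst//; exact: PD.
have [P PPP] := PP0; apply: sup_max; first by exists P => //; exact: infc.
by move=> _ [Q PPQ <-]; rewrite infc.
Qed.

End maxmin.

(** * Max-min representations and uniqueness of the utility *)

Section representation.
Context {R : realType} {d : measure_display} {S : algebraOfSetsType d}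
  {V : lmodType R}.
Variables (X : set V) (pref : (S -> V) -> (S -> V) -> Prop).
Hypothesis Xconvex : convex_set X.
Implicit Types (f g h : S -> V) (x y : V) (u v : V -> R).
Implicit Types PP : set (set (set S -> R^o)).

Lemma convex_compact_halfspace (psi : S -> R) (c : R) : simple psi ->
  (exists2 p, Delta S R p & c <= prob_integral p psi) ->
  convex_compact [set p | Delta S R p /\ c <= prob_integral p psi].
Proof.
move=> spsi [p0 Dp0 cp0]; split.
- by move=> p [].
- by exists p0.
- move=> p q w /set_mem[Dp cp] /set_mem[Dq cq]; apply/mem_set.
  have w01 : 0 <= w%:num <= 1 by rewrite ge0 le1.
  split; first exact: Delta_convex.
  have -> : conv w p q = w%:num *: (p : set S -> R^o) +
    (1 - w%:num) *: (q : set S -> R^o) by [].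
  rewrite prob_integral_convex//; move: w01 => /andP[w0 w1]; nra.
- exact: weak_star_compact_halfspace.
Qed.

Lemma exists_separating_prob u f g x y : IB_utility X pref u ->
  acts X f -> acts X g ->
  certainty_equivalent X pref f x -> certainty_equivalent X pref g y ->
  exists p, [/\ Delta S R p, prob_integral p (u \o f) <= u x &
    u y <= prob_integral p (u \o g)].
Proof.
move=> ibu Af Ag cx cy; have [[au _] _ _] := ibu.
have [Xx _] := cx; have [Xy _] := cy.
have [||s [t [w [w01 ft gt]]]] := @two_point_mixture R S
    (fun s => u (f s) - u x) (fun s => u (g s) - u y).
- exact: (simple_comp (fun v : V * V => (u v.1 - u x, u v.2 - u y))
    (simple_pair Af.1 Ag.1)).1.
- move=> a a01; apply: contrapT => n.
  have a01' : 0 <= 1 - a <= 1 by lra.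
  have := statewise_strict_dominance Xconvex ibu
    (acts_mix Xconvex Af (acts_cst Xy) a01)
    (acts_mix Xconvex Ag (acts_cst Xx) a01')
    (certainty_equivalent_mix Xconvex ibu Af cx Xy a01)
    (certainty_equivalent_mix Xconvex ibu Ag cy Xx a01').
  have H : forall s, u (mix (1 - a) g (cst x) s) < u (mix a f (cst y) s).
    move=> s; rewrite (affine_mix _ au Af (acts_cst Xy) a01).
    rewrite (affine_mix _ au Ag (acts_cst Xx) a01').
    rewrite ltNge; apply/negP => le; apply: n; exists s; lra.
  (* Both certainty equivalents have utility [a * u x + (1 - a) * u y], so a strict inequality is
     absurd. *)
  move=> /(_ H); rewrite !au//; lra.
- exists (w *: (point_mass s : set S -> R^o) +
    (1 - w) *: (point_mass t : set S -> R^o)).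
  have Ds := Delta_point_mass (R := R) s.
  have Dt := Delta_point_mass (R := R) t.
  have sf := acts_utility u Af; have sg := acts_utility u Ag.
  split; first exact: Delta_convex.
  + by rewrite prob_integral_convex// !prob_integral_point_mass//=; lra.
  + by rewrite prob_integral_convex// !prob_integral_point_mass//=; lra.
Qed.

Lemma maxmin_Pstar u f x : IB_utility X pref u -> acts X f ->
  certainty_equivalent X pref f x ->
  has_max [set inf (integrals P (u \o f)) | P in Pstar X pref u] /\
  maxmin (Pstar X pref u) (u \o f) = u x.
Proof.
move=> ibu Af cx; have su g (Ag : acts X g) := acts_utility u Ag.
pose P := [set p | Delta S R p /\ u x <= prob_integral p (u \o f)].
have Pcc : convex_compact P.
  apply: convex_compact_halfspace; first exact: su.
  by have [p [Dp _ ?]] := exists_separating_prob ibu Af Af cx cx; exists p.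
have PD : Pstar X pref u P.
  (* The separating [p] lies in the half-space of [f] and integrates [u \o g] to at most [u y],
     which bounds the infimum over the half-space. *)
  split=> // g y Ag cy.
  have [p [Dp gp fp]] := exists_separating_prob ibu Ag Af cy cx.
  apply: le_trans gp; apply: ge_inf; last by exists p.
  have [_ P0 _ Pc] := Pcc.
  by have [m _ lm] := compact_integrals_has_min P0 Pc (su _ Ag); exists m.
have infP : inf (integrals P (u \o f)) = u x.
  apply/eqP; rewrite eq_le; apply/andP; split; first exact: PD.2.
  have [_ [p Pp] _ _] := Pcc.
  apply: lb_le_inf; first by exists (prob_integral p (u \o f)), p.
  by move=> _ [q [_ +] <-].
have ubx : ubound [set inf (integrals P (u \o f)) | P in Pstar X pref u] (u x).
  by move=> _ [Q [_ Qstar] <-]; exact: Qstar.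
have memx : [set inf (integrals P (u \o f)) | P in Pstar X pref u] (u x).
  by exists P.
by split; [exists (u x)|exact: sup_max].
Qed.

Lemma Pstar_representation u : IB_utility X pref u ->
  maxmin_representation X pref u (Pstar X pref u).
Proof.
move=> ibu; have [[_ [x0 [_ [X0 _ _]]]] _ _] := ibu.
have su g (Ag : acts X g) := acts_utility u Ag.
split.
- have [[_ [P PP _] _] _] :=
    maxmin_Pstar ibu (acts_cst X0) (certainty_equivalent_cst ibu X0).
  by exists P.
- by move=> P [].
- move=> f Af; have [x cx] := certainty_equivalent_exists Xconvex ibu Af.
  split; last exact: (maxmin_Pstar ibu Af cx).1.
  move=> P [[_ P0 _ Pc] _]; apply: compact_integrals_has_min => //; exact: su.
- move=> f g Af Ag; have [x cx] := certainty_equivalent_exists Xconvex ibu Af.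
  have [y cy] := certainty_equivalent_exists Xconvex ibu Ag.
  rewrite (maxmin_Pstar ibu Af cx).2 (maxmin_Pstar ibu Ag cy).2.
  exact: (prefE ibu Af Ag cx cy).
Qed.

(** The functional fixes constants, so preferring [x] to [f] bounds the value of [f] by [u x], and
    each inner infimum lies below that value. *)
Lemma representation_sub_Pstar u PP : maxmin_representation X pref u PP ->
  PP `<=` Pstar X pref u.
Proof.
move=> [PP0 PPcc _ PPrep] P PPP; split; first exact: PPcc.
move=> f x Af [Xx [/(PPrep _ _ (acts_cst Xx) Af) + _]].
rewrite (_ : u \o cst x = cst (u x))// maxmin_cst//; apply: le_trans.
apply: ub_le_sup; last by exists P.
exact: (maxmin_has_sup PP0 PPcc (acts_utility u Af)).2.
Qed.

(** The axioms are read off the functional [J]: it is monotone, commutes with mixing with constants,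
    and varies little when an act changes little uniformly. *)
Lemma representation_IB_utility u PP : nonconstant_affine X u ->
  maxmin_representation X pref u PP -> IB_utility X pref u.
Proof.
move=> nu [PP0 PPcc _ PPrep]; have [au [x1 [x0 [X1 X0 /eqP u10]]]] := nu.
have su g (Ag : acts X g) := acts_utility u Ag.
pose J f := maxmin PP (u \o f).
have Jcst x : J (cst x) = u x by exact: (maxmin_cst PP0 PPcc (u x)).
have le f g a c : 0 < a -> acts X f -> acts X g ->
    (forall s, a * u (f s) + c <= u (g s)) -> a * J f + c <= J g.
  by move=> a0 /su sf /su sg; exact: le_maxmin.
have Jmix f x a : acts X f -> X x -> 0 < a < 1 ->
    J (mix a f (cst x)) = a * J f + (1 - a) * u x.
  move=> Af Xx /andP[a0 a1]; have Ax : acts X (cst x : S -> V) := acts_cst Xx.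
  have a01 : 0 <= a <= 1 by rewrite !ltW.
  have Am := acts_mix Xconvex Af Ax a01.
  apply/eqP; rewrite eq_le; apply/andP; split; last first.
    by apply: le => // s; rewrite (affine_mix _ au Af Ax a01).
  (* The reverse inequality is the same estimate for the inverse affine map, which recovers [u \o f]
     from the mixture. *)
  have : a^-1 * J (mix a f (cst x)) + - (a^-1 * ((1 - a) * u x)) <= J f.
    apply: le => //; first by rewrite invr_gt0.
    move=> s; rewrite (affine_mix _ au Af Ax a01) -mulrBr addrK.
    by rewrite mulKf// gt_eqF.
  by rewrite -mulrBr ler_pdivrMl// lerBlDr.
have prefJ f g : acts X f -> acts X g -> (pref f g <-> J g <= J f).
  exact: PPrep.
have strictJ f g : acts X f -> acts X g -> (strict pref f g <-> J g < J f).
  move=> Af Ag; split=> [[/prefJ fg /prefJ gf]|fg].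
    by rewrite ltNge; apply/negP => /gf; exact.
  split; first by apply/prefJ => //; exact: ltW.
  by move=> /prefJ; rewrite leNgt fg => /(_ Ag Af).
have prefc x y : X x -> X y -> (pref (cst x) (cst y) <-> u y <= u x).
  by move=> Xx Xy; rewrite prefJ ?Jcst//; exact: acts_cst.
split=> //; split.
- split.
  + wlog {u10} u01 : x1 x0 X1 X0 / u x0 < u x1.
      by move=> W; move: u10; rewrite neq_lt => /orP[/W|/W]; exact.
    exists (cst x1), (cst x0); split; [exact: acts_cst|exact: acts_cst|].
    by apply/strictJ; rewrite ?Jcst//; exact: acts_cst.
  + move=> f g Af Ag; case: (leP (J g) (J f)) => [|/ltW] ?; [left|right];
      exact/prefJ.
  + move=> f g h Af Ag Ah /(prefJ _ _ Af Ag) fg /(prefJ _ _ Ag Ah) gh.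
    by apply/prefJ => //; exact: le_trans gh fg.
- move=> f g Af Ag fg; apply/prefJ => //.
  rewrite -[J g]mul1r -[X in X <= _]addr0; apply: le => // s.
  rewrite mul1r addr0.
  exact: ((prefc _ _ (actsX s Af) (actsX s Ag)).1 (fg s)).
- move=> f g h Af Ag Ah /(strictJ _ _ Af Ag) fg /(strictJ _ _ Ag Ah) gh.
  have [M M0 Mle] : exists2 M, 0 < M & forall s, `|u (f s) - u (h s)| <= M.
    have [|s0 smax] := @finite_range_max R S (fun s => `|u (f s) - u (h s)|).
      exact: (simple_comp (fun v : V * V => `|u v.1 - u v.2|)
        (simple_pair Af.1 Ah.1)).1.
    exists (`|u (f s0) - u (h s0)| + 1); first by rewrite ltr_wpDl.
    by move=> s; rewrite (le_trans (smax s))// lerDl.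
  (* Moving an act by a fraction [t] of the way between [f] and [h] changes [J] by at most [t * M];
     this must stay below the gaps [J f - J g] and [J g - J h]. *)
  have step (e : R) : 0 < e -> exists2 t, 0 < t < 1 & t * M < e.
    move=> e0; have eM : 0 < e + M by rewrite addr_gt0.
    exists (e / (e + M)).
      by rewrite divr_gt0//= ltr_pdivrMr// mul1r ltrDl.
    by rewrite mulrAC ltr_pdivrMr// ltr_pM2l// ltrDr.
  have [|a a01 aM] := step (J f - J g); first by rewrite subr_gt0.
  have [|b b01 bM] := step (J g - J h); first by rewrite subr_gt0.
  have {a01}[a0 a1] := andP a01; have {b01}[b0 b1] := andP b01.
  have a01 : 0 <= 1 - a <= 1 by lra.
  have b01 : 0 <= b <= 1 by lra.
  exists (1 - a), b; split; [lra|lra|apply/strictJ => //|apply/strictJ => //].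
  + exact: acts_mix.
  + have : 1 * J f + - (a * M) <= J (mix (1 - a) f h).
      apply: le => //; first exact: acts_mix.
      move=> s; rewrite (affine_mix _ au Af Ah a01).
      by have := Mle s; rewrite ler_norml => /andP[_]; nra.
    lra.
  + exact: acts_mix.
  + have : 1 * J (mix b f h) + - (b * M) <= J h.
      apply: le => //; first exact: acts_mix.
      move=> s; rewrite (affine_mix _ au Af Ah b01).
      by have := Mle s; rewrite ler_norml => /andP[_]; nra.
    lra.
- move=> f g x a Af Ag Xx a01; have /andP[a0 a1] := a01.
  have a01' : 0 <= a <= 1 by rewrite !ltW.
  have Ax : acts X (cst x : S -> V) := acts_cst Xx.
  rewrite !prefJ//; try exact: acts_mix.
  by rewrite !Jmix// lerD2r ler_pM2l.
Qed.

(** Both functions order [X] alike, so points with equal [u] have equal [v]. If [x] has coordinate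
    [t] on the [u]-scale with origin [x0] and unit [x1], an equality of [u] between mixtures of [x],
    [x0], [x1] becomes one of [v], whence the same coordinate on the [v]-scale. *)
Lemma IB_utility_unique u v : IB_utility X pref u -> IB_utility X pref v ->
  exists a b : R, 0 < a /\ forall x, X x -> v x = a * u x + b.
Proof.
move=> [[au [x1 [x0 [X1 X0 /eqP u10]]]] _ pu] [[av _] _ pv].
wlog {u10} u01 : x1 x0 X1 X0 / u x0 < u x1.
  by move=> W; move: u10; rewrite neq_lt => /orP[/W|/W]; exact.
have uv x y : X x -> X y -> (u y <= u x <-> v y <= v x).
  by move=> Xx Xy; rewrite -pu// pv.
have uvE x y : X x -> X y -> u x = u y -> v x = v y.
  move=> Xx Xy uE; apply/eqP; rewrite eq_le; apply/andP.
  by split; apply/uv; rewrite ?uE.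
have v01 : v x0 < v x1.
  by rewrite ltNge; apply/negP => /uv; rewrite leNgt u01; move/(_ X0 X1).
have k0 : 0 < u x1 - u x0 by rewrite subr_gt0.
exists ((v x1 - v x0) / (u x1 - u x0)).
exists (v x0 - (v x1 - v x0) / (u x1 - u x0) * u x0); split.
  by rewrite divr_gt0// subr_gt0.
move=> x Xx; pose t := (u x - u x0) / (u x1 - u x0).
have tE : t * (u x1 - u x0) = u x - u x0 by rewrite divfK// gt_eqF.
suff : v x - v x0 = t * (v x1 - v x0).
  by move/eqP; rewrite subr_eq => /eqP ->; rewrite /t; ring.
have [t0|t0] := leP 0 t.
- have t1 : 0 < 1 + t by lra.
  (* With this weight, mixing [x] with [x0] and mixing [x0] with [x1] give the same utility, even
     when [x] is better than [x1]. *)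
  pose w := (1 + t)^-1.
  have wE : w * (1 + t) = 1 by rewrite mulVf// gt_eqF.
  have w0 : 0 < w by rewrite invr_gt0.
  have w01 : 0 <= w <= 1 by rewrite ltW//= invf_le1//; lra.
  have : v (w *: x + (1 - w) *: x0) = v (w *: x0 + (1 - w) *: x1).
    apply: uvE; [exact: convex_mem|exact: convex_mem|].
    rewrite !au//; have -> : 1 - w = w * t by lra.
    have -> : u x = u x0 + t * (u x1 - u x0) by lra.
    ring.
  rewrite !av//; have -> : 1 - w = w * t by lra.
  move=> E; apply: (mulfI (lt0r_neq0 w0)); move: E; rewrite !mulrBr; lra.
- have t1 : 0 < 1 - t by lra.
  (* Now [x] is worse than [x0], and [w] is the weight for which mixing [x] with [x1] gives the
     utility of [x0]. *)
  pose w := (1 - t)^-1.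
  have wE : w * (1 - t) = 1 by rewrite mulVf// gt_eqF.
  have w0 : 0 < w by rewrite invr_gt0.
  have w01 : 0 <= w <= 1 by rewrite ltW//= invf_le1//; lra.
  have : v (w *: x + (1 - w) *: x1) = v x0.
    apply: uvE => //; first exact: convex_mem.
    rewrite !au//; have -> : 1 - w = - (w * t) by lra.
    have -> : u x = u x0 + t * (u x1 - u x0) by lra.
    transitivity (w * (1 - t) * u x0); first by ring.
    by rewrite wE mul1r.
  rewrite !av//; have -> : 1 - w = - (w * t) by lra.
  move=> E; apply: (mulfI (lt0r_neq0 w0)); rewrite mulrBr.
  have : v x0 = w * (1 - t) * v x0 by rewrite wE mul1r.
  move: E; rewrite !mulrBr; lra.
Qed.

End representation.

(** * The linear functional of a total Archimedean cone *)

Section archimedean_functional.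
Context {R : realType} {V : lmodType R}.
Variables (L C : set V) (e : V).
Hypotheses (L_lin : forall (a : R) v w, L v -> L w -> L (a *: v + w))
  (Le : L e).
Hypotheses (C_add : forall v w, C v -> C w -> C (v + w))
  (C_scale : forall (a : R) v, 0 <= a -> C v -> C (a *: v)).
Hypotheses (C_total : forall v, L v -> C v \/ C (- v))
  (C_arch : forall v w, L v -> L w -> ~ C (- w) ->
    exists2 eps : R, 0 < eps & C (w - eps *: v)).
Hypothesis ePos : ~ C (- e).

Let L0 : L 0.
Proof. by rewrite -(addNr e) -scaleN1r; exact: L_lin. Qed.

Let L_scale (a : R) v : L v -> L (a *: v).
Proof. by move=> Lv; rewrite -[_ *: _]addr0; exact: L_lin. Qed.

Let LB v w : L v -> L w -> L (v - w).
Proof. by move=> Lv Lw; rewrite addrC -scaleN1r; exact: L_lin. Qed.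

Let C_scale_e (t : R) : C (t *: e) -> 0 <= t.
Proof.
move=> Cte; rewrite leNgt; apply/negP => t0; apply: ePos.
have : C ((- t)^-1 *: (t *: e)).
  by apply: C_scale => //; rewrite invr_ge0 oppr_ge0 ltW.
by rewrite scalerA invrN mulNr mulVf ?scaleN1r// lt_eqF.
Qed.

Let C_between v (t t' : R) : C (v - t *: e) -> C (t' *: e - v) -> t <= t'.
Proof.
move=> vt tv; have := C_add tv vt; rewrite addrA subrK -scalerBl => /C_scale_e.
by rewrite subr_ge0.
Qed.

(** The lineality space of the cone. The functional sends [v] to the unique [t] such that
    [v - t *: e] falls in it, so its linearity comes from [N_lin]. *)
Let N := [set v | C v /\ C (- v)].

Let N_lin (a : R) v w : N v -> N w -> N (a *: v + w).
Proof.
move=> [v1 v2] [w1 w2].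
have aux (b : R) : C (b *: v).
  have [b0|/ltW b0] := leP 0 b; first exact: C_scale.
  by rewrite -[v]opprK scalerN -scaleNr; apply: C_scale => //; rewrite oppr_ge0.
by split; [|rewrite opprD -scaleNr]; exact: C_add.
Qed.

(** The coefficient is the supremum of those [t] with [v - t *: e] in the cone. The Archimedean
    hypothesis, used against [v] and against [- v], bounds this set above and makes it nonempty. *)
Let N_exists v : L v -> exists t : R, N (v - t *: e).
Proof.
move=> Lv; pose E := [set t : R | C (v - t *: e)].
have [eps eps0 Ceps] := C_arch Lv Le ePos.
have ub t : E t -> t <= eps^-1.
  move=> Et; apply: C_between Et _.
  have := C_scale (ltW (_ : 0 < eps^-1)) Ceps; rewrite invr_gt0 => /(_ eps0).
  by rewrite scalerBr scalerA mulVf ?scale1r// gt_eqF.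
have LNv : L (- v) by rewrite -scaleN1r; exact: L_scale.
have [del del0] := C_arch LNv Le ePos; rewrite scalerN opprK => Cdel.
have E1 : E (- del^-1).
  have := C_scale (ltW (_ : 0 < del^-1)) Cdel; rewrite invr_gt0 => /(_ del0).
  rewrite scalerDr scalerA mulVf ?gt_eqF// scale1r.
  by rewrite /E /= scaleNr opprK addrC.
have supE : has_sup E by split; [exists (- del^-1)|exists eps^-1].
have LT : L (v - sup E *: e) by apply: LB => //; exact: L_scale.
exists (sup E); split; apply: contrapT => n.
(* If either membership failed at the supremum, the Archimedean hypothesis would leave room for a
   step [h]: here [sup E - h] would bound [E], and in the other case [sup E + h] would belong to
   [E]. *)
- have [||h h0] := C_arch (w := sup E *: e - v) Le.
  + by rewrite -opprB -scaleN1r; exact: L_scale.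
  + by rewrite opprB.
  + rewrite addrAC -scalerBl => Ch.
    suff : sup E <= sup E - h by lra.
    by apply: ge_sup; [exists (- del^-1)|move=> t Et; exact: C_between Et Ch].
- have [h h0] := C_arch Le LT n.
  rewrite -addrA -opprD -scalerDl => Eh.
  have := sup_upper_bound supE Eh; lra.
Qed.

Let N_unique v (t t' : R) : N (v - t *: e) -> N (v - t' *: e) -> t = t'.
Proof.
move=> [t1 t2] [t'1 t'2]; apply/eqP; rewrite eq_le; apply/andP; split.
  by apply: C_between t1 _; rewrite -opprB.
by apply: C_between t'1 _; rewrite -opprB.
Qed.

Lemma archimedean_functional : exists phi : V -> R, [/\ phi e = 1,
  forall (a : R) v w, L v -> L w -> phi (a *: v + w) = a * phi v + phi w &
  forall v, L v -> (C v <-> 0 <= phi v)].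
Proof.
have [phi phiP] : exists phi : V -> R, forall v, L v -> N (v - phi v *: e).
  have /choice[phi phiP] v : exists t : R, L v -> N (v - t *: e).
    have [Lv|nLv] := pselect (L v); last by exists 0.
    by have [t Nt] := N_exists Lv; exists t.
  by exists phi.
have C0 : C 0 by have [|] := C_total L0; rewrite ?oppr0.
exists phi; split.
- by apply: N_unique (phiP _ Le) _; rewrite scale1r subrr /N /= oppr0.
- move=> a v w Lv Lw; apply: N_unique (phiP _ (L_lin a Lv Lw)) _.
  have := N_lin a (phiP _ Lv) (phiP _ Lw).
  by rewrite scalerBr scalerA addrACA -opprD -scalerDl.
- move=> v Lv; have [v1 v2] := phiP _ Lv; split=> [Cv|p0].
    by have := C_add Cv v2; rewrite opprB addrC subrK => /C_scale_e.
  have Ce : C e by case: (C_total Le).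
  by rewrite -(subrK (phi v *: e) v); apply: C_add => //; exact: C_scale.
Qed.

End archimedean_functional.

(** * Affine utility on constant acts *)

Section von_Neumann_Morgenstern.
Context {R : realType} {d : measure_display} {S : algebraOfSetsType d}
  {V : lmodType R}.
Variables (X : set V) (pref : (S -> V) -> (S -> V) -> Prop).
Hypotheses (Xconvex : convex_set X) (IB : invariant_biseparable X pref).
Implicit Types (f g h : S -> V) (x y z : V) (a b s t : R).

Let P x y := pref (cst x) (cst y).

Let P_total x y : X x -> X y -> P x y \/ P y x.
Proof.
by have [[_ tot _] _ _ _] := IB => Xx Xy; apply: tot; exact: acts_cst.
Qed.

Let P_trans x y z : X x -> X y -> X z -> P x y -> P y z -> P x z.
Proof.
by have [[_ _ tr] _ _ _] := IB => Xx Xy Xz; apply: tr; exact: acts_cst.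
Qed.

Let P_mix x y z a : X x -> X y -> X z -> 0 < a < 1 ->
  (P x y <-> P (a *: x + (1 - a) *: z) (a *: y + (1 - a) *: z)).
Proof.
by have [_ _ _ ci] := IB => Xx Xy Xz a01; apply: ci => //; exact: acts_cst.
Qed.

Let P_nontrivial : exists x y, [/\ X x, X y & ~ P y x].
Proof.
have [[[f [g [Af Ag [fg ngf]]]] _ _] mono _ _] := IB.
apply: contrapT => n; apply: ngf; apply: mono => // s.
apply: contrapT => nP; apply: n; exists (f s), (g s).
by split; [exact: (actsX s Af)|exact: (actsX s Ag)|exact: nP].
Qed.

Let L := [set v | exists s x y, [/\ 0 < s, X x, X y & v = s *: (x - y)]].
Let C := [set v | exists s x y,
  [/\ 0 < s, X x, X y & v = s *: (x - y) /\ P x y]].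

(** Preference between constants depends only on the direction of their difference. With
    [a = s / (s + s')], the hypothesis gives [a *: x + (1 - a) *: y' = a *: y + (1 - a) *: x']; mix
    [x], [y] with [y'], then cancel [y] from the mixtures of [x'], [y'] with it. *)
Let P_direction x y x' y' s s' : 0 < s -> 0 < s' ->
  X x -> X y -> X x' -> X y' ->
  s *: (x - y) = s' *: (x' - y') -> P x y -> P x' y'.
Proof.
move=> s0 s'0 Xx Xy Xx' Xy' E Pxy.
have k0 : 0 < s + s' by rewrite addr_gt0.
pose a := s / (s + s'); have aE : 1 - a = s' / (s + s').
  by rewrite /a; field; rewrite gt_eqF.
have a0 : 0 < a by rewrite divr_gt0.
have a1 : 0 < 1 - a by rewrite aE divr_gt0.
have a01 : 0 < a < 1 by lra.
have a01' : 0 < 1 - a < 1 by lra.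
have : a *: (x - y) = (1 - a) *: (x' - y').
  by rewrite aE /a ![_ / _]mulrC -!scalerA E.
rewrite !scalerBr => /eqP; rewrite subr_eq addrAC eq_sym subr_eq => /eqP {}E.
apply/(P_mix Xx' Xy' Xy a01').
have -> : 1 - (1 - a) = a by ring.
by rewrite E [_ *: y' + _]addrC; exact: ((P_mix Xx Xy Xy' a01).1 Pxy).
Qed.

Let sum_directions s s' x y x' y' (a := s / (s + s')) : 0 < s -> 0 < s' ->
  s *: (x - y) + s' *: (x' - y') =
  (s + s') *: ((a *: x + (1 - a) *: x') - (a *: y + (1 - a) *: y')).
Proof.
move=> s0 s'0; have k0 : s + s' != 0 by rewrite gt_eqF ?addr_gt0.
rewrite opprD addrACA -!scalerBr [(s + s') *: _]scalerDr !scalerA.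
congr (_ *: _ + _ *: _).
  by rewrite /a; field.
by rewrite /a; field.
Qed.

Let weight01 s s' : 0 < s -> 0 < s' -> 0 < s / (s + s') < 1.
Proof.
move=> s0 s'0; have k0 : 0 < s + s' by rewrite addr_gt0.
by rewrite divr_gt0//= ltr_pdivrMr// mul1r ltrDl.
Qed.

Let ltW01 a : 0 < a < 1 -> 0 <= a <= 1.
Proof. by move=> /andP[a0 a1]; rewrite !ltW. Qed.

Let C_add v w : C v -> C w -> C (v + w).
Proof.
move=> [s [x [y [s0 Xx Xy [-> Pxy]]]]] [s' [x' [y' [s'0 Xx' Xy' [-> Pxy']]]]].
have a01 := weight01 s0 s'0; have a01' := ltW01 a01.
rewrite sum_directions//; set a := s / _ in a01 a01' *.
exists (s + s'), (a *: x + (1 - a) *: x'), (a *: y + (1 - a) *: y').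
have X1 := convex_mem Xconvex Xx Xx' a01'.
have X2 := convex_mem Xconvex Xy Xy' a01'.
split=> //; first by rewrite addr_gt0.
(* Through the intermediate point, [x] and [x'] are replaced by [y] and [y'] one at a time, each
   time by C-independence. *)
split=> //; apply: (P_trans X1 (convex_mem Xconvex Xy Xx' a01') X2).
  exact: ((P_mix Xx Xy Xx' a01).1 Pxy).
have b01 : 0 < 1 - a < 1 by lra.
have := P_mix Xx' Xy' Xy b01; rewrite subKr.
rewrite [a *: y + _ *: x']addrC [a *: y + _ *: y']addrC => H.
exact: (H.1 Pxy').
Qed.

Let L_add v w : L v -> L w -> L (v + w).
Proof.
move=> [s [x [y [s0 Xx Xy ->]]]] [s' [x' [y' [s'0 Xx' Xy' ->]]]].
have /ltW01 a01' := weight01 s0 s'0.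
rewrite sum_directions//; set a := s / _ in a01' *.
exists (s + s'), (a *: x + (1 - a) *: x'), (a *: y + (1 - a) *: y').
by split; [rewrite addr_gt0|exact: convex_mem|exact: convex_mem|].
Qed.

Let L_opp v : L v -> L (- v).
Proof.
move=> [s [x [y [s0 Xx Xy ->]]]]; exists s, y, x; split=> //.
by rewrite -scalerN opprB.
Qed.

Let zero_direction v : L v -> exists2 x, X x & 0 = 1 *: (x - x) :> V.
Proof.
by move=> [s [x [y [s0 Xx Xy _]]]]; exists x; rewrite ?subrr ?scaler0.
Qed.

Let L_scale a v : L v -> L (a *: v).
Proof.
wlog a0 : a v / 0 <= a.
  move=> W Lv; have [/W|/ltW a0] := leP 0 a; first exact.
  rewrite -[v]opprK scalerN -scaleNr.
  by apply: W; rewrite ?oppr_ge0//; exact: L_opp.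
move=> /[dup] Lv [s [x [y [s0 Xx Xy ->]]]].
move: a0; rewrite le_eqVlt => /orP[/eqP <-|a0].
  by rewrite scale0r; have [z Xz E] := zero_direction Lv; exists 1, z, z.
by exists (a * s), x, y; rewrite scalerA; split=> //; exact: mulr_gt0.
Qed.

Let P_refl x : X x -> P x x.
Proof. by move=> Xx; case: (P_total Xx Xx). Qed.

Let C_scale a v : 0 <= a -> C v -> C (a *: v).
Proof.
move=> a0 [s [x [y [s0 Xx Xy [-> Pxy]]]]].
move: a0; rewrite le_eqVlt => /orP[/eqP <-|a0].
  exists 1, x, x; rewrite subrr scaler0 scale0r; split=> //; split=> //.
  exact: P_refl.
by exists (a * s), x, y; rewrite scalerA; split=> //; exact: mulr_gt0.
Qed.

Let C_direction x y s : X x -> X y -> 0 < s -> (C (s *: (x - y)) <-> P x y).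
Proof.
move=> Xx Xy s0; split; last by move=> Pxy; exists s, x, y.
move=> [s' [x' [y' [s'0 Xx' Xy' [E P']]]]].
exact: (P_direction s'0 s0 Xx' Xy' Xx Xy (esym E)).
Qed.

Let C_total v : L v -> C v \/ C (- v).
Proof.
move=> [s [x [y [s0 Xx Xy ->]]]]; rewrite -scalerN opprB.
by rewrite !C_direction//; exact: P_total.
Qed.

Let half01 : 0 < (2^-1 : R) < 1. Proof. by lra. Qed.

(** When both directions are strictly improving, midpoints give a chain [m x' x], [m y' x], [m y' y]
    of strictly decreasing preference. The Archimedean axiom ranks the middle one above a mixture of
    the outer ones, and the difference is a positive multiple of [w - eps *: v]. *)
Let C_arch v w : L v -> L w -> ~ C (- w) ->
  exists2 eps : R, 0 < eps & C (w - eps *: v).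
Proof.
move=> /[dup] Lv [s' [x' [y' [s'0 Xx' Xy' vE]]]].
move=> /[dup] Lw [s [x [y [s0 Xx Xy wE]]]] nw.
have Cw : C w by case: (C_total Lw).
have [Cv|nv] := pselect (C (- v)).
  by exists 1 => //; rewrite scale1r; exact: C_add.
have nyx : ~ P y x.
  by move=> Pyx; apply: nw; rewrite wE -scalerN opprB C_direction.
have nyx' : ~ P y' x'.
  by move=> Pyx; apply: nv; rewrite vE -scalerN opprB C_direction.
have half01' := ltW01 half01.
pose m x y : V := 2^-1 *: x + (1 - 2^-1) *: y.
have Xm z z' : X z -> X z' -> X (m z z') by move=> *; exact: convex_mem.
have strictm z z' x2 : X z -> X z' -> X x2 -> ~ P z' z ->
    strict pref (cst (m z x2)) (cst (m z' x2)).
  move=> Xz Xz' X2 n; have [Pz|//] := P_total Xz Xz'.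
  split; first exact: ((P_mix Xz Xz' X2 half01).1 Pz).
  by move=> /(P_mix Xz' Xz X2 half01).
have mC z z' : m z z' = m z' z.
  by rewrite /m addrC; congr (_ *: _ + _ *: _); field.
have [_ _ arch _] := IB.
have Ac z : X z -> acts X (cst z : S -> V) by exact: acts_cst.
have [_ [b [_ /andP[b0 b1] _ [+ _]]]] := arch _ _ _ (Ac _ (Xm _ _ Xx' Xx))
  (Ac _ (Xm _ _ Xy' Xx)) (Ac _ (Xm _ _ Xy' Xy)) (strictm _ _ _ Xx' Xy' Xx nyx')
  ltac:(by rewrite (mC y' x) (mC y' y); exact: strictm).
rewrite mix_cst => Pb.
have b1' : 0 < 1 - b by rewrite subr_gt0.
have Xb : X (b *: m x' x + (1 - b) *: m y' y).
  by apply: convex_mem; rewrite ?(ltW b0) ?(ltW b1) //; exact: Xm.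
have := (C_direction (Xm _ _ Xy' Xx) Xb ltr01).2 Pb; rewrite scale1r.
have -> : m y' x - (b *: m x' x + (1 - b) *: m y' y) =
    (1 - b) *: (m y' x - m y' y) - b *: (m x' x - m y' x).
  rewrite !scalerBr opprB addrACA [(1 - b) *: m y' x + _]addrC -scalerDl.
  by rewrite addrC [b + _]addrC subrK scale1r opprD addrC [- _ - _]addrC.
have -> : m y' x - m y' y = 2^-1 *: (x - y).
  by rewrite mC (mC y' y) /m opprD addrACA subrr addr0 -scalerBr.
have -> : m x' x - m y' x = 2^-1 *: (x' - y').
  by rewrite /m opprD addrACA subrr addr0 -scalerBr.
move=> /(C_scale (a := 2 * s / (1 - b))) H.
(* Scaling the difference by [2 * s / (1 - b)] makes its first term [w]; the coefficient then left
   on [v] is this one. *)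
exists (s * b / ((1 - b) * s')); first by rewrite divr_gt0 ?mulr_gt0.
have /H : 0 <= 2 * s / (1 - b) by rewrite divr_ge0 ?mulr_ge0 ?ltW.
rewrite wE vE scalerBr !scalerA; congr (C (_ *: _ - _ *: _)); field.
  by rewrite gt_eqF.
by rewrite !gt_eqF.
Qed.

Lemma IB_utility_exists : exists u, IB_utility X pref u.
Proof.
have [x1 [x0 [X1 X0 n01]]] := P_nontrivial.
have LX x y : X x -> X y -> L (x - y).
  by move=> Xx Xy; exists 1, x, y; rewrite scale1r.
have CX x y : X x -> X y -> (C (x - y) <-> P x y).
  by move=> Xx Xy; rewrite -C_direction// scale1r.
have [||phi [phi1 phi_lin phiP]] := @archimedean_functional R V L C (x1 - x0) _
  (LX _ _ X1 X0) C_add C_scale C_total C_arch.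
- by move=> a v w Lv Lw; apply: L_add => //; exact: L_scale.
- by rewrite opprB CX.
(* This normalizes the utility to 0 at [x0] and 1 at [x1]. *)
pose u x := phi (x - x0).
have uB x y : X x -> X y -> u x = phi (x - y) + u y.
  move=> Xx Xy; rewrite /u -[phi (x - y)]mul1r -phi_lin; [|exact: LX|exact: LX].
  by rewrite scale1r addrA subrK.
exists u; split=> //.
- split.
    move=> x y a Xx Xy a01; have Xa := convex_mem Xconvex Xx Xy a01.
    rewrite (uB _ y)// (uB x y)//.
    have -> : a *: x + (1 - a) *: y - y = a *: (x - y) + (y - y).
      by rewrite subrr addr0 scalerBl scale1r scalerBr addrA addrAC addrK.
    rewrite phi_lin; [|exact: LX|exact: LX].
    have := uB _ _ Xy Xy; lra.
  exists x1, x0; split=> //; rewrite (uB x1 x0)// phi1; lra.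
- move=> x y Xx Xy; rewrite -/(P x y) -CX// phiP; last exact: LX.
  by rewrite (uB x y)// lerDr.
Qed.

End von_Neumann_Morgenstern.

(** * Duality between max-min and min-max *)

Section dual_extrema.
Context {R : realType}.
Implicit Types A B : set R.

Lemma sup_imageN A : sup [set - x | x in A] = - inf A.
Proof. by rewrite /inf opprK. Qed.

Lemma inf_imageN A : inf [set - x | x in A] = - sup A.
Proof.
rewrite /inf image_comp; congr (- sup _).
by rewrite -[RHS]image_id; apply: eq_imagel => x _ /=; rewrite opprK.
Qed.

Lemma has_min_imageN A : has_min [set - x | x in A] <-> has_max A.
Proof.
split=> [[_ [m Am <-] lm]|[m Am um]].
  by exists m => // x Ax; rewrite -lerN2; apply: lm; exists x.
by exists (- m); [exists m|move=> _ [x Ax <-]; rewrite lerN2; exact: um].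
Qed.

Lemma has_max_imageN A : has_max [set - x | x in A] <-> has_min A.
Proof.
split=> [[_ [m Am <-] lm]|[m Am um]].
  by exists m => // x Ax; rewrite -lerN2; apply: lm; exists x.
by exists (- m); [exists m|move=> _ [x Ax <-]; rewrite lerN2; exact: um].
Qed.

End dual_extrema.

Section dual_integrals.
Context {R : realType} {d : measure_display} {S : algebraOfSetsType d}.
Implicit Types (phi : S -> R) (P : set (set S -> R^o)).
Implicit Types QQ : set (set (set S -> R^o)).

Lemma integralsN P phi : P `<=` Delta S R -> simple phi ->
  integrals P (- phi) = [set - x | x in integrals P phi].
Proof.
move=> PD sphi; rewrite image_comp; apply: eq_imagel => p Pp /=.
by rewrite prob_integralN//; exact: PD.
Qed.

Lemma inf_integralsN P phi : P `<=` Delta S R -> simple phi ->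
  inf (integrals P (- phi)) = - sup (integrals P phi).
Proof. by move=> PD sphi; rewrite integralsN// inf_imageN. Qed.

Lemma inf_integralsN_image QQ phi :
  (forall Q, QQ Q -> Q `<=` Delta S R) -> simple phi ->
  [set inf (integrals Q (- phi)) | Q in QQ] =
  [set - x | x in [set sup (integrals Q phi) | Q in QQ]].
Proof.
move=> QD sphi; rewrite image_comp; apply: eq_imagel => Q QQQ /=.
by rewrite inf_integralsN//; exact: QD.
Qed.

Lemma maxminN QQ phi : (forall Q, QQ Q -> Q `<=` Delta S R) -> simple phi ->
  maxmin QQ (- phi) = - minmax QQ phi.
Proof.
by move=> QD sphi; rewrite /maxmin inf_integralsN_image// sup_imageN.
Qed.

Lemma maxmin_attainedN QQ phi :
  (forall Q, QQ Q -> Q `<=` Delta S R) -> simple phi ->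
  (maxmin_attained QQ (- phi) <-> minmax_attained QQ phi).
Proof.
move=> QD sphi; rewrite /maxmin_attained inf_integralsN_image//.
rewrite has_max_imageN; split=> -[m1 m2]; split=> // Q QQQ.
  by apply/has_min_imageN; rewrite -integralsN//; [exact: m1|exact: QD].
by rewrite integralsN//; [apply/has_min_imageN; exact: m1|exact: QD].
Qed.

End dual_integrals.

Definition dual_pref {T : Type} (pref : T -> T -> Prop) : T -> T -> Prop :=
  fun f g => pref g f.

Section duality.
Context {R : realType} {d : measure_display} {S : algebraOfSetsType d}
  {V : lmodType R}.
Variable X : set V.
Implicit Types (pref : (S -> V) -> (S -> V) -> Prop) (u : V -> R).
Implicit Types QQ : set (set (set S -> R^o)).

Lemma mixC (a : R) (f g : S -> V) : mix a f g = mix (1 - a) g f.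
Proof. by rewrite /mix subKr addrC. Qed.

Lemma IB_dual pref : invariant_biseparable X pref ->
  invariant_biseparable X (dual_pref pref).
Proof.
move=> [[[f [g [Af Ag fg]]] tot tr] mono arch ci]; split.
- split.
  + by exists g, f; split.
  + by move=> h k Ah Ak; case: (tot h k Ah Ak); [right|left].
  + by move=> h k l Ah Ak Al hk kl; apply: (tr l k h).
- by move=> h k Ah Ak hk; apply: mono.
- move=> h k l Ah Ak Al hk kl.
  have [a [b [a01 b01 ak kb]]] := arch l k h Al Ak Ah kl hk.
  (* Reversal exchanges the outer acts, so the two weights swap and are replaced by their
     complements. *)
  exists (1 - b), (1 - a); rewrite -mixC -mixC; split=> //; lra.
- by move=> h k x a Ah Ak Xx a01; apply: ci.
Qed.

Lemma nonconstant_affineN u : nonconstant_affine X u ->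
  nonconstant_affine X (- u).
Proof.
move=> [au [x [y [Xx Xy uxy]]]]; split.
  by move=> z t a Xz Xt a01; rewrite !fctE au//; ring.
by exists x, y; split=> //; rewrite !fctE => /oppr_inj.
Qed.

Lemma IB_utility_dual pref u : IB_utility X pref u ->
  IB_utility X (dual_pref pref) (- u).
Proof.
move=> [nu IB pu]; split; [exact: nonconstant_affineN|exact: IB_dual|].
by move=> x y Xx Xy; rewrite /dual_pref pu// !fctE lerN2.
Qed.

Lemma IB_utilityN_dual pref u : IB_utility X (dual_pref pref) (- u) ->
  IB_utility X pref u.
Proof. by move/IB_utility_dual; rewrite opprK. Qed.

Lemma comp_oppf u (f : S -> V) : (- u) \o f = - (u \o f).
Proof. by []. Qed.

Lemma minmax_representation_dual pref u QQ :
  minmax_representation X pref u QQ <->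
  maxmin_representation X (dual_pref pref) (- u) QQ.
Proof.
have su f : acts X f -> simple (u \o f) by exact: acts_utility.
split=> -[QQ0 QQcc att rep]; split=> //;
  have QD Q : QQ Q -> Q `<=` Delta S R by move=> /QQcc[].
- by move=> f Af; rewrite comp_oppf maxmin_attainedN//; [exact: att|exact: su].
- move=> f g Af Ag; rewrite /dual_pref rep// !comp_oppf.
  by rewrite !maxminN ?lerN2//; exact: su.
- by move=> f Af; rewrite -maxmin_attainedN//; [exact: att|exact: su].
- move=> f g Af Ag; rewrite -[pref f g]/(dual_pref pref g f) rep// !comp_oppf.
  by rewrite !maxminN ?lerN2//; exact: su.
Qed.

Lemma Qstar_dual pref u : Qstar X pref u = Pstar X (dual_pref pref) (- u).
Proof.
apply/seteqP; split=> Q [Qcc Qle]; split=> // f x Af [Xx [xf fx]];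
  have [QD _ _ _] := Qcc; have su := acts_utility u Af.
  rewrite comp_oppf inf_integralsN// lerN2; exact: Qle.
by rewrite -lerN2 -inf_integralsN//; exact: Qle.
Qed.

End duality.

(** * Maximal families and the equivalence theorem *)

Lemma maximal_family_greatest {T : Type} (C : set (set T)) (F0 : set T) :
  C F0 -> (forall F, C F -> F `<=` F0) ->
  forall F, maximal_family C F <-> F = F0.
Proof.
move=> CF0 le F; split=> [[CF maxF]|->].
  by apply/esym/maxF => //; exact: le.
by split=> // G CG F0G; apply/seteqP; split=> //; exact: le.
Qed.

Section utility.
Context {R : realType} {d : measure_display} {S : algebraOfSetsType d}
  {V : lmodType R}.
Variables (X : set V) (pref : (S -> V) -> (S -> V) -> Prop).
Hypothesis Xconvex : convex_set X.
Implicit Types u v : V -> R.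

(** Uniqueness can thus be proved once, whichever kind of representation [u] and [v] come from. *)
Lemma utilityE u : utility X pref u <-> IB_utility X pref u.
Proof.
split=> [[nu [[PP rep]|[QQ /minmax_representation_dual rep]]]|ibu].
- exact: representation_IB_utility rep.
- apply: IB_utilityN_dual; apply: representation_IB_utility rep => //.
  exact: nonconstant_affineN.
- have [nu _ _] := ibu; split=> //; left; exists (Pstar X pref u).
  exact: Pstar_representation.
Qed.

Lemma Qstar_representation u : IB_utility X pref u ->
  minmax_representation X pref u (Qstar X pref u).
Proof.
move=> ibu; apply/minmax_representation_dual; rewrite Qstar_dual.
by apply: Pstar_representation => //; exact: IB_utility_dual.
Qed.

Lemma representation_sub_Qstar u QQ : minmax_representation X pref u QQ ->
  QQ `<=` Qstar X pref u.
Proof.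
by move/minmax_representation_dual/representation_sub_Pstar; rewrite Qstar_dual.
Qed.

Lemma IB_utility_positive_affine u v (a b : R) : IB_utility X pref u -> 0 < a ->
  (forall x, X x -> v x = a * u x + b) -> IB_utility X pref v.
Proof.
move=> [[au [x [y [Xx Xy uxy]]]] IB pu] a0 vE; split=> //.
- split.
    move=> z t c Xz Xt c01; have Xc := convex_mem Xconvex Xz Xt c01.
    by rewrite !vE// au//; ring.
  exists x, y; split=> //.
  by rewrite !vE// => /addIr/(mulfI (lt0r_neq0 a0)); exact: uxy.
- by move=> z t Xz Xt; rewrite pu// !vE// lerD2r ler_pM2l.
Qed.

End utility.

Theorem theorem4p1 (R : realType) (d : measure_display)
    (S : algebraOfSetsType d) (V : lmodType R) (X : set V)
    (pref : (S -> V) -> (S -> V) -> Prop)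
    (X0 : X !=set0) (Xconvex : convex_set X) :
  [/\ invariant_biseparable X pref <->
        exists u : V -> R, nonconstant_affine X u /\
          exists PP, maxmin_representation X pref u PP,
      invariant_biseparable X pref <->
        exists u : V -> R, nonconstant_affine X u /\
          exists QQ, minmax_representation X pref u QQ
    & forall u : V -> R, utility X pref u ->
      [/\ forall v : V -> R, utility X pref v <->
            exists a b : R, 0 < a /\ forall x, X x -> v x = a * u x + b,
          forall f, acts X f -> exists x, certainty_equivalent X pref f x,
          (forall PP, maximal_family (maxmin_representation X pref u) PP <->
             PP = Pstar X pref u) /\
          (forall PP, maxmin_representation X pref u PP ->
             PP `<=` Pstar X pref u)
        & (forall QQ, maximal_family (minmax_representation X pref u) QQ <->
             QQ = Qstar X pref u) /\
          (forall QQ, minmax_representation X pref u QQ ->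
             QQ `<=` Qstar X pref u)]].
Proof.
split.
- split=> [/(IB_utility_exists Xconvex)[u ibu]|[u [nu [PP rep]]]].
    exists u; split; first by case: ibu.
    by exists (Pstar X pref u); exact: Pstar_representation.
  suff [_ ? _] : IB_utility X pref u by [].
  by apply/utilityE => //; split=> //; left; exists PP.
- split=> [/(IB_utility_exists Xconvex)[u ibu]|[u [nu [QQ rep]]]].
    exists u; split; first by case: ibu.
    by exists (Qstar X pref u); exact: Qstar_representation.
  suff [_ ? _] : IB_utility X pref u by [].
  by apply/utilityE => //; split=> //; right; exists QQ.
- move=> u /(utilityE _ Xconvex) ibu; split.
  + move=> v; rewrite utilityE//; split=> [ibv|[a [b [a0 vE]]]].
      exact: IB_utility_unique ibu ibv.
    exact: IB_utility_positive_affine ibu a0 vE.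
  + by move=> f Af; exact: (certainty_equivalent_exists Xconvex ibu Af).
  + split; last by move=> PP; exact: representation_sub_Pstar.
    apply: maximal_family_greatest; first exact: Pstar_representation.
    by move=> PP; exact: representation_sub_Pstar.
  + split; last by move=> QQ; exact: representation_sub_Qstar.
    apply: maximal_family_greatest; first exact: Qstar_representation.
    by move=> QQ; exact: representation_sub_Qstar.
Qed.
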